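(* Let $D$ be a dendrite and suppose that $f:D\to D$ is continuous and all its periodic points are weakly repelling. Then $f$ has infinitely many periodic cutpoints.
   Context: A dendrite is a locally connected (metric) continuum containing no simple closed curve. A point $x$ is a cutpoint of $D$ if $D\setminus\{x\}$ has more than one component; a point $x$ separates $y$ from $z$ if $y,z$ lie in distinct components of $D\setminus\{x\}$. Let $g:D\to D$ be continuous and $a\in D$ a fixed point of $g$. If there is a component $B$ of $D\setminus\{a\}$ such that arbitrarily close to $a$ in $B$ there exist fixed cutpoints of $g$ (i.e. cutpoints of $D$ fixed by $g$) or points $x$ separating $a$ from $g(x)$, then $a$ is a weakly repelling fixed point of $g$ in $B$. A periodic point $a$ of $f$ is weakly repelling if there exist $n\ge 1$ and a component $B$ of $D\setminus\{a\}$ such that $a$ is a weakly repelling fixed point of $f^n$ in $B$. *)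

(* Defs.v *)
From HB Require Import structures.
From mathcomp Require Import all_boot all_order all_algebra.
From mathcomp Require Import all_classical all_reals all_analysis.

Set Implicit Arguments.
Unset Strict Implicit.
Unset Printing Implicit Defensive.

Import Order.TTheory GRing.Theory Num.Theory.
Import numFieldNormedType.Exports.

Local Open Scope classical_set_scope.
Local Open Scope ring_scope.

(* Homeomorphism of subspaces; the values of the ambient functions outside A
   and B are irrelevant. *)
Definition homeomorphic {X Y : topologicalType} (A : set X) (B : set Y) : Prop :=
  exists (h : X -> Y) (k : Y -> X),
    [/\ {within A, continuous h}, {within B, continuous k},
        set_fun A B h, set_fun B A k &
        {in A, cancel h k} /\ {in B, cancel k h}].

Definition unit_circle (R : realType) : set (R * R) :=
  [set p | p.1 ^+ 2 + p.2 ^+ 2 = 1].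

Definition simple_closed_curve (R : realType) (T : topologicalType)
    (S : set T) : Prop :=
  homeomorphic (@unit_circle R) S.

Definition locally_connected (T : topologicalType) : Prop :=
  forall (x : T) (U : set T), nbhs x U ->
    exists V : set T, [/\ open V, connected V, V x & V `<=` U].

(* The library's [connected] holds for the empty set, hence [!=set0]. *)
Definition continuum (T : topologicalType) : Prop :=
  [/\ [set: T] !=set0, compact [set: T] & connected [set: T]].

Definition dendrite (R : realType) (D : metricType R) : Prop :=
  [/\ continuum D, locally_connected D &
      ~ exists S : set D, simple_closed_curve R S].

Definition components {T : topologicalType} (A : set T) : set (set T) :=
  connected_component A @` A.

Definition cutpoint {T : topologicalType} (x : T) : Prop :=
  exists C1 C2 : set T,
    [/\ components (~` [set x]) C1, components (~` [set x]) C2 & C1 <> C2].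

Definition separates {T : topologicalType} (x y z : T) : Prop :=
  exists C1 C2 : set T,
    [/\ components (~` [set x]) C1, components (~` [set x]) C2, C1 <> C2,
        C1 y & C2 z].

Definition weakly_repelling_fixed_in {T : topologicalType} (g : T -> T) (a : T)
    (B : set T) : Prop :=
  [/\ g a = a, components (~` [set a]) B &
      forall U : set T, nbhs a U -> exists x : T,
        [/\ U x, B x & (g x = x /\ cutpoint x) \/ separates x a (g x)]].

Definition periodic_point {T : Type} (f : T -> T) (x : T) : Prop :=
  exists n : nat, (0 < n)%N /\ iter n f x = x.

Definition weakly_repelling {T : topologicalType} (f : T -> T) (a : T) : Prop :=
  exists (n : nat) (B : set T),
    (0 < n)%N /\ weakly_repelling_fixed_in (iter n f) a B.

(* Main.v *)
Require Import Defs.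
From HB Require Import structures.
From mathcomp Require Import all_boot all_order all_algebra.
From mathcomp Require Import all_classical all_reals all_analysis.
From mathcomp Require Import ring lra.

Set Implicit Arguments.
Unset Strict Implicit.
Unset Printing Implicit Defensive.

Import Order.TTheory GRing.Theory Num.Theory.
Import numFieldNormedType.Exports.

Local Open Scope classical_set_scope.
Local Open Scope ring_scope.

(* Topology: in a Peano continuum open connected sets are path connected, and a
   path contains an arc once its loops are erased.  If two points of an arc were
   still linked after removing an interior point [z] of the arc, a path avoiding
   [z] would close a simple closed curve.  Hence [seg p q], the set of points
   which do not leave [p] and [q] in one component, is the unique arc from [p]
   to [q].

   Dynamics: suppose the set [F] of periodic cutpoints is finite, and let [g] be
   an iterate of [f] that moves points away from each [e] in [F] along some
   component of the complement of [e].  From a point [x] that [g] moves, follow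
   points [y] with [g y] ahead of [y]; a maximal such itinerary ends at a fixed
   point [e] of [g], towards which [g] pushes all of [seg x e].  If [e] is a
   cutpoint, it repels in a component not containing [x], and a point [x'] there
   close to [e] has fewer points of [F] in the component of its complement
   containing [g x']; so [x] can be chosen such that [e] is an endpoint.  Near an
   endpoint, without periodic cutpoints, iterates of an outward (inward) map are
   outward (inward); as [f^n] is outward at [e] for some [n], this is
   contradictory. *)

(** * Path connectedness of open connected sets *)

Section metric_facts.
Context {R : realType} {D : metricType R}.

Lemma nbhs_mdistE (x : D) (U : set D) :
  nbhs x U <-> exists2 e : R, 0 < e & forall y, mdist x y < e -> U y.
Proof.
rewrite -metricType_numDomainType.filter_from_mdist_nbhs.
by split => -[e e0 h]; exists e.
Qed.

Lemma continuous_pathP (g : R -> D) : continuous g <->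
  forall t (e : R), 0 < e -> exists2 d : R, 0 < d &
    forall s, `|t - s| < d -> mdist (g t) (g s) < e.
Proof.
split=> [cg t e e0|h t U /nbhs_mdistE[e e0 eU]].
  have : nbhs (g t) [set y | mdist (g t) y < e] by apply/nbhs_mdistE; exists e.
  by move/(cg t)/nbhs_ballP => [d d0 h]; exists d.
have [d d0 hd] := h t e e0.
by apply/nbhs_ballP; exists d => // s /hd /eU.
Qed.

Lemma continuous_if_le (f g : R -> D) (c : R) :
  continuous f -> continuous g -> f c = g c ->
  continuous (fun t => if t <= c then f t else g t).
Proof.
move=> /continuous_pathP cf /continuous_pathP cg fg; apply/continuous_pathP.
move=> t e e0; have [d1 d10 h1] := cf t e e0; have [d2 d20 h2] := cg t e e0.
have [tc|ct|tc] := ltgtP t c.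
- exists (Num.min d1 (c - t)); first by rewrite lt_min d10 subr_gt0.
  move=> s; rewrite lt_min => /andP[sd sc].
  have -> : s <= c by move: sc; rewrite distrC ltr_norml => /andP[_]; lra.
  exact: h1.
- exists (Num.min d2 (t - c)); first by rewrite lt_min d20 subr_gt0.
  move=> s; rewrite lt_min => /andP[sd sc].
  have -> : (s <= c) = false.
    by apply/negbTE; rewrite -ltNge; move: sc; rewrite ltr_norml => /andP[_]; lra.
  exact: h2.
- exists (Num.min d1 d2); first by rewrite lt_min d10.
  move=> s; rewrite lt_min => /andP[sd1 sd2]; case: ifP => _; first exact: h1.
  by rewrite tc fg -tc; exact: h2.
Qed.

End metric_facts.

(** Relates the index of a time on a grid refined by the factor [M] to its index on the coarse
    grid. *)
Lemma truncn_mul_div (R : realType) (x : R) (M : nat) : 0 <= x -> (0 < M)%N ->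
  (Num.truncn (x * M%:R) %/ M)%N = Num.truncn x.
Proof.
move=> x0 M0; have MR : 0 < M%:R :> R by rewrite ltr0n.
have xM0 : 0 <= x * M%:R by rewrite mulr_ge0 // ltW.
have /andP[a1 a2] := truncn_itv xM0; have /andP[b1 b2] := truncn_itv x0.
set a := Num.truncn (x * _) in a1 a2 *; set b := Num.truncn x in b1 b2 *.
have h1 : (b * M <= a)%N.
  rewrite -ltnS -(ltr_nat R) (le_lt_trans _ a2) // natrM ler_pM2r //.
have h2 : (a < b.+1 * M)%N.
  by rewrite -(ltr_nat R) natrM (le_lt_trans a1) // ltr_pM2r.
by apply/eqP; rewrite eqn_leq leq_divRL // h1 andbT -ltnS ltn_divLR.
Qed.

Section chains.
Context {R : realType} {D : metricType R}.

(** The points reached from [x] by such chains form a subset of [V] that is both open and closed in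
    [V]. A chain is a total sequence, constant from [m] on, so that chains can be padded to a common
    length. *)
Lemma connected_chain (V : set D) (x y : D) (h : R) : connected V -> V x -> V y ->
  0 < h -> exists (m : nat) (c : nat -> D), [/\ c 0%N = x, forall i, (m <= i)%N -> c i = y,
    forall i, V (c i) & forall i, mdist (c i) (c i.+1) < h].
Proof.
move=> cV Vx Vy h0.
pose P z := exists (m : nat) (c : nat -> D), [/\ c 0%N = x,
    forall i, (m <= i)%N -> c i = z,
    forall i, V (c i) & forall i, mdist (c i) (c i.+1) < h].
have PV z : P z -> V z by move=> [m [c [_ cz Vc _]]]; rewrite -(cz m).
have ext z w : P z -> V w -> mdist z w < h -> P w.
  move=> [m [c [c0 cz Vc dc]]] Vw zw.
  exists m.+1, (fun i => if (i <= m)%N then c i else w); split => //.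
  - by move=> i mi; rewrite leqNgt mi.
  - by move=> i; case: ifP.
  - move=> i; have [im|] := ltnP i m; first by rewrite (ltnW im).
    rewrite leq_eqVlt => /orP[/eqP <-|mi]; first by rewrite leqnn cz.
    by rewrite leqNgt mi /= mdistxx.
suff PVE : [set z | P z] = V by rewrite -PVE in Vy.
apply: cV.
- exists x, 0%N, (fun=> x); split => // i; by rewrite mdistxx.
- exists (\bigcup_(z in P) (ball z h)°).
    by apply: bigcup_open => z _; exact: open_interior.
  apply/seteqP; split => [z Pz|z [Vz [w Pw]]].
    by split; [exact: PV|exists z => //; exact: nbhsx_ballx].
  by move=> /interior_subset; rewrite ballEmdist => /= wz; apply: (ext w).
- exists (closure P); first exact: closed_closure.
  apply/seteqP; split => [z Pz|z [Vz]].
    by split; [exact: PV|exact: subset_closure].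
  move=> /(_ (ball z h)) []; first exact: nbhsx_ballx.
  by move=> w [Pw]; rewrite ballEmdist /= metric_sym => /(ext w z Pw Vz).
Qed.

Hypothesis Dc : compact [set: D].
Hypothesis Dlc : locally_connected D.

(** A Lebesgue number argument: each point has a connected neighbourhood of radius [e / 2], which
    serves all nearby points at scale [e], and compactness gives one [h] for all of them. *)
Lemma uniformly_locally_connected (e : R) : 0 < e -> exists2 h : R, 0 < h &
  forall x y : D, mdist x y < h ->
    exists V : set D, [/\ connected V, V x, V y & forall z, V z -> mdist x z < e].
Proof.
move=> e0; have /compact_near_coveringP nc := Dc.
have := nc R (0:R)^'+ (fun h x => forall y, mdist x y < h ->
    exists V : set D, [/\ connected V, V x, V y & forall z, V z -> mdist x z < e]) _.
case.
  move=> x _.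
  have xe2 : nbhs x (ball x (e / 2)) by apply: nbhsx_ballx; lra.
  have [V [oV cV Vx Ve]] := Dlc xe2.
  have /nbhs_mdistE[r r0 rV] : nbhs x V by exact: open_nbhs_nbhs.
  exists (ball x (r / 2), [set t | 0 < t < r / 2]).
    split => /=; first by apply: nbhsx_ballx; lra.
    exists (r / 2) => /=; first lra.
    move=> t /=; rewrite sub0r normrN => tr t0; rewrite t0 /=.
    by rewrite gtr0_norm in tr.
  move=> [x' h] /= [xx' /andP[h0 hr]] y x'y; exists V; split => //.
  - by apply: rV; rewrite ballEmdist /= in xx'; lra.
  - apply: rV; rewrite ballEmdist /= in xx'.
    by have := metric_triangle x x' y; lra.
  - have Vx' : V x' by apply: rV; rewrite ballEmdist /= in xx'; lra.
    move=> z /Ve; move/Ve: Vx'; rewrite !ballEmdist /=.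
    by have := metric_triangle x' x z; rewrite (metric_sym x' x); lra.
move=> d /= d0 hd; exists (d / 2); first lra.
move=> x y; apply: (hd (d / 2)) => //=; last lra.
by rewrite sub0r normrN gtr0_norm; lra.
Qed.

(** Encodes a step function on the unit interval: [st.1] is the number of equal steps, [st.2 i] the
    value on step [i], and [q] the value from time 1 on. *)
Definition step_chain (p q : D) (h : R) (st : nat * (nat -> D)) :=
  [/\ (0 < st.1)%N, st.2 0%N = p, forall i, (st.1 <= i)%N -> st.2 i = q &
    forall i, mdist (st.2 i) (st.2 i.+1) < h].

(** Each jump is bridged by a finer chain inside a connected set of size [e]. All bridges are padded
    to the same length [M], so step [j] of the new chain stems from step [j %/ M] of the old one. *)
Lemma step_chain_refine (p q : D) (e h h' : R) st : 0 < h' ->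
  (forall x y : D, mdist x y < h ->
    exists V : set D, [/\ connected V, V x, V y & forall z, V z -> mdist x z < e]) ->
  step_chain p q h st -> exists (M : nat) st', [/\ (0 < M)%N, st'.1 = (st.1 * M)%N,
    step_chain p q h' st' & forall j, mdist (st'.2 j) (st.2 (j %/ M)%N) < e].
Proof.
case: st => K s h'0 ulc [/= K0 s0 sq sd].
have /choice[mc Hmc] : forall i, exists mc : nat * (nat -> D), [/\ mc.2 0%N = s i,
    forall j, (mc.1 <= j)%N -> mc.2 j = s i.+1,
    forall j, mdist (s i) (mc.2 j) < e & forall j, mdist (mc.2 j) (mc.2 j.+1) < h'].
  move=> i; have [V [cV Vx Vy Ve]] := ulc _ _ (sd i).
  have [m [c [c0 cm Vc dc]]] := connected_chain cV Vx Vy h'0.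
  by exists (m, c); split => //= j; apply: Ve.
have e0 : 0 < e by have [_ _ /(_ 0%N)/(le_lt_trans (mdist_ge0 _ _))] := Hmc 0%N.
(* The sum bounds every bridge length, and the successor lets each bridge reach its target by its
   last index [M.-1]. *)
pose M := (\sum_(i < K) (mc i).1).+1.
have mM i : (i < K)%N -> ((mc i).1 <= M.-1)%N.
  by move=> iK; rewrite /M /= (bigD1 (Ordinal iK)) //= leq_addr.
pose s' j := if (j %/ M < K)%N then (mc (j %/ M)%N).2 (j %% M)%N else q.
exists M, ((K * M)%N, s'); split => //=.
- split => /=.
  + by rewrite muln_gt0 K0.
  + by rewrite /s' div0n K0 mod0n; have [-> _ _ _] := Hmc 0%N.
  + by move=> i KMi; rewrite /s' ltnNge leq_divRL // KMi.
  + move=> j; rewrite /s' divnS // modnS; case: (boolP (M %| j.+1)%N) => [Mj|Mj]; last first.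
      rewrite add0n; case: ifP => _; last by rewrite mdistxx.
      by have [_ _ _ ->] := Hmc (j %/ M)%N.
    have jM : (j %% M = M.-1)%N.
      have := ltn_pmod j (isT : (0 < M)%N); rewrite ltnS => jM.
      apply/eqP; rewrite eqn_leq jM /=.
      move: Mj; rewrite {1}(divn_eq j M) -addnS dvdn_addr ?dvdn_mull //.
      by move/dvdn_leq => /(_ isT); rewrite ltnS.
    rewrite add1n; case: ifP => jK; last first.
      have -> : ((j %/ M).+1 < K)%N = false by apply/negbTE; rewrite -leqNgt; move/negbT: jK; rewrite -leqNgt => /leqW.
      by rewrite mdistxx.
    have [_ cj _ _] := Hmc (j %/ M)%N; rewrite cj; last by rewrite jM; exact: mM.
    case: ifP => jK1; first by have [-> _ _ _] := Hmc (j %/ M).+1; rewrite mdistxx.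
    by rewrite sq ?mdistxx // leqNgt jK1.
- move=> j; rewrite /s'; case: ifP => jK.
    by rewrite metric_sym; have [_ _ -> _] := Hmc (j %/ M)%N.
  by rewrite sq ?mdistxx // leqNgt jK.
Qed.

(* The path is the uniform limit of step functions whose jumps tend to 0. *)
Lemma uniformly_locally_path_connected (e : R) : 0 < e -> exists2 h : R, 0 < h &
  forall p q : D, mdist p q < h -> exists g : R -> D,
    [/\ continuous g, g 0 = p, g 1 = q & forall t, mdist p (g t) < e].
Proof.
(* The tolerances halve, so those from [n] on sum to [2 * en n]. The first step function is within
   [en 0] of [p], hence the limit is within [3 * en 0 < e]. *)
move=> e0; pose en n : R := e / 4 / 2 ^+ n.
have en0 n : 0 < en n by rewrite !divr_gt0 // exprn_gt0.
have enS n : en n = 2 * en n.+1 by rewrite /en exprS invfM; lra.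
have /choice[hn Hhn] : forall n, exists h : R, [/\ 0 < h, h <= en n & forall x y : D, mdist x y < h ->
    exists V : set D, [/\ connected V, V x, V y & forall z, V z -> mdist x z < en n]].
  move=> n; have [h h0 H] := uniformly_locally_connected (en0 n).
  exists (Num.min h (en n)); split; rewrite ?lt_min ?h0 ?ge_min ?lexx ?orbT ?en0 //.
  by move=> x y; rewrite lt_min => /andP[/H].
exists (hn 0%N) => [|p q pq]; first by have [] := Hhn 0%N.
have /choice[F HF] : forall nst : nat * (nat * (nat -> D)),
    exists Mst : nat * (nat * (nat -> D)), step_chain p q (hn nst.1) nst.2 ->
    [/\ (0 < Mst.1)%N, Mst.2.1 = (nst.2.1 * Mst.1)%N,
    step_chain p q (hn nst.1.+1) Mst.2 & forall j, mdist (Mst.2.2 j) (nst.2.2 (j %/ Mst.1)%N) < en nst.1].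
  move=> [n st]; have [H|nH] := pselect (step_chain p q (hn n) st); last by exists (0%N, st).
  have [_ _ ulc] := Hhn n; have [h'0 _ _] := Hhn n.+1.
  have [M [st' HM]] := step_chain_refine h'0 ulc H.
  by exists (M, st').
pose st := fix st n := if n is m.+1 then (F (m, st m)).2 else (1%N, fun i => if i is 0 then p else q).
have Hst n : step_chain p q (hn n) (st n).
  elim: n => [|n IH]; last by have [] := HF (n, st n) IH.
  by split => //= -[|i] //; rewrite mdistxx; have [] := Hhn 0%N.
pose g n (t : R) := (st n).2 (Num.truncn (Num.max 0 t * (st n).1%:R)).
have gS n t : mdist (g n t) (g n.+1 t) < en n.
  have [/= M0 stM _] := HF (n, st n) (Hst n).
  move=> /(_ (Num.truncn (Num.max 0 t * (st n.+1).1%:R))).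
  rewrite metric_sym /g /= stM natrM mulrA truncn_mul_div //.
  by rewrite mulr_ge0 // le_max lexx.
have gD n k t : mdist (g n t) (g (n + k)%N t) <= 2 * en n - 2 * en (n + k)%N.
  elim: k => [|k IH]; first by rewrite addn0 subrr mdistxx.
  rewrite addnS (le_trans (metric_triangle _ (g (n + k)%N t) _)) //.
  by have := gS (n + k)%N t; have := enS (n + k)%N; lra.
have en_small (d : R) : 0 < d -> exists n, en n < d.
  move=> d0; have e4d : 0 <= e / 4 / d by rewrite !divr_ge0 // ltW.
  exists (Num.bound (e / 4 / d)); rewrite /en ltr_pdivrMr ?exprn_gt0 // [X in _ < X]mulrC -ltr_pdivrMr //.
  by rewrite (lt_trans (archi_boundP e4d)) // -natrX ltr_nat ltn_expl.
have /choice[L HL] : forall t, exists x, forall n, mdist (g n t) x <= 2 * en n.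
  (* Compactness provides a cluster point, and the geometric bound [gD] passes to it. *)
  move=> t; pose Fl := (fun n => g n t) @ \oo.
  have [x [_ clx]] : [set: D] `&` cluster Fl !=set0.
    by apply: Dc; exact: filterT.
  exists x => n; apply/ler_addgt0Pr => d d0.
  have Fn : Fl [set y | mdist (g n t) y <= 2 * en n].
    exists n => // k /= nk; rewrite -(subnKC nk) (le_trans (gD _ _ _)) //.
    by have := en0 (n + (k - n))%N; lra.
  have xd : nbhs x [set y | mdist x y < d] by apply/nbhs_mdistE; exists d.
  have [y [/= y1 y2]] := clx _ _ Fn xd.
  have := metric_triangle (g n t) y x; rewrite (metric_sym y x); lra.
have Lunique t x : (forall n, g n t = x) -> L t = x.
  move=> gx; apply/esym/mdist_positivity/eqP; rewrite eq_le mdist_ge0 andbT.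
  apply/ler_addgt0Pr => d d0; have [n nd] : exists n, en n < d / 2 by apply: en_small; lra.
  by have := HL t n; rewrite gx; lra.
exists L; split.
- apply/continuous_pathP => t d d0.
  (* Times closer than one step of the grid lie on the same or on adjacent steps, so [g n] varies by
     less than [en n]; replacing [L] by [g n] at both times costs [2 * en n] each, whence the 5. *)
  have [n nd] : exists n, en n < d / 5 by apply: en_small; lra.
  have [K0 _ _ Hs] := Hst n.
  have K0R : 0 < (st n).1%:R :> R by rewrite ltr0n.
  exists (st n).1%:R^-1; first by rewrite invr_gt0.
  move=> s ts; suff gts : mdist (g n t) (g n s) < en n.
    have := HL t n; have := HL s n; have := metric_triangle (L t) (g n t) (L s).
    have := metric_triangle (g n t) (g n s) (L s).
    by rewrite (metric_sym (L t) (g n t)); lra.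
  wlog : t s ts / t <= s.
    move=> H; have [/H|/ltW/H] := leP t s; first exact.
    by rewrite metric_sym distrC; apply.
  move=> tles; rewrite /g.
  set a := _ * _; set b := Num.max 0 s * _.
  have a0 : 0 <= a by rewrite mulr_ge0 // le_max lexx.
  have b0 : 0 <= b by rewrite mulr_ge0 // le_max lexx.
  have ab : a <= b by rewrite ler_pM2r // ge_max !le_max lexx tles orbT.
  have ba1 : b < a + 1.
    rewrite -ltrBlDl -mulrBl -ltr_pdivlMr // mul1r (le_lt_trans _ ts) //.
    rewrite distrC ger0_norm ?subr_ge0 //.
    by case: (leP 0 t) => t0; case: (leP 0 s) => s0; lra.
  have : (Num.truncn a <= Num.truncn b)%N by apply: le_truncn.
  rewrite leq_eqVlt => /orP[/eqP ->|tab]; first by rewrite mdistxx.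
  have -> : Num.truncn b = (Num.truncn a).+1.
    apply/eqP; rewrite eqn_leq tab andbT.
    have /andP[b1 b2] := truncn_itv b0; have /andP[a1 a2] := truncn_itv a0.
    rewrite -ltnS -(ltr_nat R) (le_lt_trans b1) // (lt_trans ba1) //.
    by rewrite -[X in _ < X]natr1 ltrD2r.
  by have [_ hle _] := Hhn n; exact: lt_le_trans (Hs _) hle.
- apply: Lunique => n; rewrite /g maxxx mul0r truncn0.
  by have [_ -> _ _] := Hst n.
- apply: Lunique => n; rewrite /g max_r // mul1r natrK.
  by have [_ _ -> //] := Hst n.
- move=> t; have g0t : mdist p (g 0%N t) < en 0%N.
    rewrite /g /=; case: (Num.truncn _) => [|i] /=; first by rewrite mdistxx.
    by have [_ hle _] := Hhn 0%N; exact: lt_le_trans pq hle.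
  have := HL t 0%N; have := metric_triangle p (g 0%N t) (L t).
  by move: g0t; rewrite /en expr0 divr1; lra.
Qed.

(** The points joined to [p] by a path in [U] form a set open and closed in [U], as points close to
    each other are joined by small paths. *)
Lemma open_connected_path (U : set D) (p q : D) : open U -> connected U -> U p ->
  U q -> exists g : R -> D, [/\ continuous g, g 0 = p, g 1 = q & forall t, U (g t)].
Proof.
move=> oU cU Up Uq.
pose P z := exists g : R -> D, [/\ continuous g, g 0 = p, g 1 = z & forall t, U (g t)].
have PU z : P z -> U z by move=> [g [_ _ <- Ug]].
have loc z : U z -> exists2 h : R, 0 < h & forall w, mdist z w < h ->
    [/\ P z -> P w & P w -> P z].
  move=> Uz; have /nbhs_mdistE[e e0 eU] : nbhs z U by exact: open_nbhs_nbhs.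
  have e20 : 0 < e / 2 by lra.
  have [h h0 hP] := uniformly_locally_path_connected e20.
  have cat x y : P x -> (exists g : R -> D, [/\ continuous g, g 0 = x, g 1 = y &
      forall t, U (g t)]) -> P y.
    move=> [g1 [c1 g10 g11 U1]] [g2 [c2 g20 g21 U2]].
    exists (fun t => if t <= 2^-1 then g1 (2 * t) else g2 (2 * t - 1)).
    have half : 2 * 2^-1 = 1 :> R by lra.
    split.
    - apply: continuous_if_le; last by rewrite half subrr g11 g20.
        by move=> t; apply: continuous_comp; [exact: mulrl_continuous|exact: c1].
      move=> t; apply: (@continuous_comp _ _ _ (fun t : R => 2 * t - 1)); last exact: c2.
      by apply: cvgB; [exact: mulrl_continuous|exact: cvg_cst].
    - by rewrite invr_ge0 ler0n mulr0.
    - have -> : (1 <= 2^-1 :> R) = false by apply/negbTE; rewrite -ltNge; lra.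
      by have -> : 2 * 1 - 1 = 1 :> R by lra.
    - by move=> t; case: ifP.
  exists (Num.min h (e / 2)); first by rewrite lt_min h0; lra.
  move=> w; rewrite lt_min => /andP[zw1 zw2]; split => Px; apply: cat Px _.
    have [g [cg g0 g1 gz]] := hP _ _ zw1.
    by exists g; split => // t; apply: eU; have := gz t; lra.
  have [g [cg g0 g1 gz]] : exists g : R -> D, [/\ continuous g, g 0 = w, g 1 = z &
      forall t, mdist w (g t) < e / 2] by apply: hP; rewrite metric_sym.
  exists g; split => // t; apply: eU.
  by have := metric_triangle z w (g t); have := gz t; lra.
suff PUE : [set z | P z] = U by rewrite -PUE in Uq.
apply: cU.
- by exists p, (fun=> p); split => // t; apply: cvg_cst.
- exists (P°); first exact: open_interior.
  apply/seteqP; split => z; last by move=> [_ /interior_subset].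
  move=> Pz; split; first exact: PU.
  have [h h0 hP] := loc z (PU _ Pz).
  by apply/nbhs_mdistE; exists h => // w /hP[/(_ Pz)].
- exists (closure P); first exact: closed_closure.
  apply/seteqP; split => [z Pz|z [Uz clz]].
    by split; [exact: PU|exact: subset_closure].
  have [h h0 hP] := loc z Uz.
  have /clz[w [Pw zw]] : nbhs z [set w | mdist z w < h] by apply/nbhs_mdistE; exists h.
  by have [_ /(_ Pw)] := hP w zw.
Qed.

End chains.

(** * From paths to arcs *)

Section real_facts.
Context {R : realType}.

Lemma closed_last (A : set R) (x c : R) : closed A -> A x -> x <= c ->
  exists m, [/\ A m, x <= m, m <= c & forall y, A y -> y <= c -> y <= m].
Proof.
move=> cA Ax xc; pose B := A `&` [set y | y <= c].
have B0 : B !=set0 by exists x.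
have ubB : has_ubound B by exists c => y [].
have cB : closed B by apply: closedI => //; exact: closed_le.
have [Am mc] : B (sup B) by apply: cB; exact: closure_sup.
exists (sup B); split => //; first by apply: ub_le_sup.
by move=> y Ay yc; apply: ub_le_sup.
Qed.

Lemma closed_first (A : set R) (x c : R) : closed A -> A x -> c <= x ->
  exists m, [/\ A m, m <= x, c <= m & forall y, A y -> c <= y -> m <= y].
Proof.
move=> cA Ax cx.
have cNA : closed [set y | A (- y)].
  by apply: (@preimage_closed _ _ -%R) => // y _; exact: opp_continuous.
have [m [Am xm mc mmax]] := @closed_last _ (- x) (- c) cNA ltac:(by rewrite /= opprK) ltac:(by rewrite lerN2).
exists (- m); split => //; [lra|lra|move=> y Ay cy].
by rewrite lerNl; apply: mmax; rewrite /= ?opprK ?lerN2.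
Qed.

(** Retraction of the line onto the unit interval; it extends paths to all of [R]. *)
Definition clamp (t : R) : R := Num.max 0 (Num.min t 1).

Lemma clampP (t : R) : [\/ t <= 0 /\ clamp t = 0, 0 <= t <= 1 /\ clamp t = t |
  1 <= t /\ clamp t = 1].
Proof.
rewrite /clamp; case: (leP t 1) => [t1|/ltW t1].
  by case: (leP 0 t) => t0; [apply: Or32; rewrite ?t0 ?t1|apply: Or31; split => //; exact: ltW].
by apply: Or33; split => //; apply: max_r.
Qed.

Lemma clamp_itv t : 0 <= clamp t <= 1.
Proof. by case: (clampP t) => -[? ->]; lra. Qed.

Lemma clamp_id t : 0 <= t <= 1 -> clamp t = t.
Proof. by case: (clampP t) => -[? ->]; lra. Qed.

Lemma clamp_le0 t : t <= 0 -> clamp t = 0.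
Proof. by case: (clampP t) => -[? ->]; lra. Qed.

Lemma clamp_ge1 t : 1 <= t -> clamp t = 1.
Proof. by case: (clampP t) => -[? ->]; lra. Qed.

Lemma le_clamp s t : s <= t -> clamp s <= clamp t.
Proof. by case: (clampP t) => -[? ->]; case: (clampP s) => -[? ->]; lra. Qed.

Lemma clamp_lipschitz s t : `|clamp s - clamp t| <= `|s - t|.
Proof.
wlog st : s t / s <= t.
  by move=> H; have [|/ltW] := leP s t => /H //; rewrite distrC (distrC s).
rewrite distrC (distrC s) !ger0_norm ?subr_ge0 ?le_clamp //.
by case: (clampP t) => -[? ->]; case: (clampP s) => -[? ->]; lra.
Qed.

Lemma clamp_continuous : continuous clamp.
Proof.
move=> t U /nbhs_ballP[e e0 eU]; apply/nbhs_ballP; exists e => // s ts.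
by apply: eU; rewrite /ball /=; exact: le_lt_trans (clamp_lipschitz _ _) ts.
Qed.

(* Weights [2^-(k+1)] make [S] continuous whenever the [f k] are equicontinuous,
   while [S] still sees a strict variation of a single [f k]. *)
Lemma weighted_sum (f : nat -> R -> R) :
  (forall k t, 0 <= f k t <= 2 ^- k.+1) ->
  exists S : R -> R,
    (forall t t' e, 0 <= e -> (forall k, f k t <= f k t' + e * 2 ^- k.+1) ->
      S t <= S t' + e) /\
    (forall t t', (forall k, f k t' <= f k t) -> (exists k, f k t' < f k t) ->
      S t' < S t).
Proof.
move=> f01; pose P n t := \sum_(k < n) f k t.
pose E t := [set P n t | n in [set: nat]].
have geo n : \sum_(k < n) 2 ^- k.+1 <= 1 :> R.
  suff -> : \sum_(k < n) 2 ^- k.+1 = 1 - 2 ^- n :> R.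
    by rewrite lerBlDr lerDl invr_ge0 exprn_ge0.
  elim: n => [|n IH]; first by rewrite big_ord0 expr0 invr1 subrr.
  by rewrite big_ord_recr /= IH exprS invfM; lra.
have ubE t : has_ubound (E t).
  exists 1 => _ [n _ <-]; rewrite (le_trans _ (geo n)) //.
  by apply: ler_sum => k _; have /andP[] := f01 k t.
have E0 t : E t !=set0 by exists (P 0%N t), 0%N.
have PS n t : P n t <= sup (E t) by apply: ub_le_sup => //; exists n.
have Pmono n m t : (n <= m)%N -> P n t <= P m t.
  move=> /subnKC <-; elim: (m - n)%N => [|k IH]; first by rewrite addn0.
  rewrite addnS (le_trans IH) // /P big_ord_recr /= lerDl.
  by have /andP[] := f01 (n + k)%N t.
exists (fun t => sup (E t)); split.
- move=> t t' e e0 fle; apply: ge_sup => // _ [n _ <-].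
  have : P n t <= P n t' + e * \sum_(k < n) 2 ^- k.+1.
    by rewrite mulr_sumr -big_split /=; apply: ler_sum.
  move/le_trans; apply; apply: lerD => //.
  by rewrite -[leRHS]mulr1 ler_wpM2l.
- move=> t t' fle [k fk].
  (* The gain at index [k] is present in every partial sum long enough to contain [k], so it
     survives in the supremum. *)
  apply: (@le_lt_trans _ _ (sup (E t) - (f k t - f k t'))); last first.
    by rewrite ltrBlDr ltrDl subr_gt0.
  apply: ge_sup => // _ [n _ <-]; rewrite lerBrDr.
  apply: le_trans (PS (maxn n k.+1) t).
  apply: (@le_trans _ _ (P (maxn n k.+1) t' + (f k t - f k t'))).
    by rewrite lerD2r Pmono // leq_maxl.
  have km : (k < maxn n k.+1)%N by rewrite leq_maxr.
  rewrite /P (bigD1 (Ordinal km)) //= [leRHS](bigD1 (Ordinal km)) //=.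
  rewrite addrAC addrCA subrr addr0 lerD2l.
  by apply: ler_sum.
Qed.

End real_facts.

Section loop_erasure.
Context {R : realType} {D : metricType R}.

(** Fibres are intervals: the path may pause but never returns to a point it has left. *)
Definition loop_free (g : R -> D) :=
  forall s u t, s <= u -> u <= t -> g s = g t -> g u = g s.

(* By maximality, collapsing the components of [G] leaves no loop of [g]. *)
Lemma maximal_loop_set (g : R -> D) : continuous g ->
  exists G : set R, [/\ open G, G `<=` [set x | 0 < x < 1],
    forall a b, a < b -> ~ G a -> ~ G b -> (forall x, a < x < b -> G x) -> g a = g b &
    forall s t, 0 <= s -> s < t -> t <= 1 -> ~ G s -> ~ G t -> g s = g t ->
      forall x, s < x < t -> G x].
Proof.
move=> /[dup] cg /continuous_pathP cgP.
pose P (G : set R) := [/\ open G, G `<=` [set x | 0 < x < 1] &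
    forall a b, a < b -> ~ G a -> ~ G b -> (forall x, a < x < b -> G x) -> g a = g b].
have [G [[oO G01 Ggap] Gmax]] : exists G, P G /\ forall G', G `<` G' -> ~ P G'.
  apply: Zorn_bigcup => F FP Ftot; split.
  - by apply: bigcup_open => G /FP[].
  - by move=> x [G /FP[_ G01 _]] /G01.
  (* By compactness one member of the chain covers the interval up to [h] at both ends. Its own
     component there ends within [h] of [a] and of [b], with equal values of [g], so [g a] and [g b]
     are arbitrarily close. *)
  move=> a b ab Fa Fb Fab; apply/mdist_positivity/eqP.
  rewrite eq_le mdist_ge0 andbT; apply/ler_addgt0Pr => e e0; rewrite add0r.
  have [d1 d10 h1] := cgP a (e / 2) ltac:(lra).
  have [d2 d20 h2] := cgP b (e / 2) ltac:(lra).
  pose m := Num.min (Num.min d1 d2) (b - a).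
  have m0 : 0 < m by rewrite !lt_min d10 d20 subr_gt0.
  have [m1 m2 m3] : [/\ m <= d1, m <= d2 & m <= b - a].
    by split; rewrite !ge_min lexx ?orbT.
  pose h := m / 3.
  have [h0 hd1 hd2 hab] : [/\ 0 < h, h < d1, h < d2 & a + h < b - h].
    by rewrite /h; split; lra.
  have [G FO Gh] : exists2 G, F G & `[a + h, b - h] `<=` G.
    have [G0 FO0] : exists G, F G.
      by have [|G FO _] := Fab ((a + b) / 2) _; [lra|exists G].
    pose tail G := [set G' | F G' /\ G `<=` G'].
    have Ff : Filter (filter_from F tail).
      apply: filter_from_filter; first by exists G0.
      move=> G1 G2 F1 F2; have [G12|G21] := Ftot _ _ F1 F2.
        by exists G2 => // G' [FO' G2']; split; split => //; exact: subset_trans G2'.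
      by exists G1 => // G' [FO' G1']; split; split => //; exact: subset_trans G1'.
    have /compact_near_coveringP nc := @segment_compact R (a + h) (b - h).
    have [|G1 FO1 sub] := nc _ (filter_from F tail) (fun G' x => G' x) Ff.
      move=> x; rewrite /= in_itv /= => /andP[x1 x2].
      have [|G FO Gx] := Fab x; first by rewrite (lt_le_trans _ x1) ?(le_lt_trans x2); lra.
      exists (G, tail G); last by move=> [x' G'] /= [? [_ ]]; apply.
      split => /=; last by exists G.
      by have [oO _ _] := FP _ FO; exact: open_nbhs_nbhs.
    by exists G1 => //; exact: (sub G1 (conj FO1 (@subset_refl _ _))).
  have [oO _ Ggap] := FP _ FO.
  have cO : closed (~` G) by exact: open_closedC.
  have Gseg x : a + h <= x <= b - h -> G x by move=> xh; apply: Gh; rewrite /= in_itv.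
  have nOa : (~` G) a by move=> Ga; apply: Fa; exists G.
  have nOb : (~` G) b by move=> Ga; apply: Fb; exists G.
  have [a' [Ga' aa' a'h a'max]] := @closed_last _ _ a (a + h) cO nOa ltac:(lra).
  have [b' [Gb' bb' b'h b'max]] := @closed_first _ _ b (b - h) cO nOb ltac:(lra).
  have gab' : g a' = g b'.
    apply: Ggap => // [|x /andP[a'x xb']]; first lra.
    apply: contrapT => nOx.
    have [xh|xh] := leP x (a + h); first by have := a'max _ nOx xh; lra.
    have [xh'|xh'] := leP (b - h) x; first by have := b'max _ nOx xh'; lra.
    by apply: nOx; apply: Gseg; lra.
  have ga : mdist (g a) (g a') < e / 2 by apply: h1; rewrite ltr_norml; lra.
  have gb : mdist (g b) (g b') < e / 2 by apply: h2; rewrite ltr_norml; lra.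
  have := metric_triangle (g a) (g a') (g b).
  by rewrite {2}gab' (metric_sym (g b') (g b)); lra.
exists G; split => // s t s0 st t1 Gs Gt gst x xst.
apply: contrapT => nOx; apply: (Gmax (G `|` [set y | s < y < t])).
  split; first by move=> y Gy; left.
  by move=> /(_ x) sub; apply: nOx; apply: sub; right.
split.
- apply: openU => //; rewrite (_ : [set y | s < y < t] = `]s, t[%classic); first exact: itv_open.
  by apply/seteqP; split => y /=; rewrite in_itv.
- by move=> y [/G01 //|/= ?]; lra.
(* As [s] and [t] stay outside the enlarged set, its interval from [a] to [b] is either the new one
   or lies to one side of it. *)
- move=> a b ab Ga Gb Gab.
  have sab : ~ (a < s < b) by move=> /Gab[//|/=]; lra.
  have tab : ~ (a < t < b) by move=> /Gab[//|/=]; lra.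
  have ast : ~ (s < a < t) by move=> ?; apply: Ga; right.
  have bst : ~ (s < b < t) by move=> ?; apply: Gb; right.
  have [bs|sb] := leP b s.
    apply: Ggap => //; [by move=> ?; apply: Ga; left|by move=> ?; apply: Gb; left|].
    by move=> y yab; have [//|/=] := Gab y yab; lra.
  have [ta|at_] := leP t a.
    apply: Ggap => //; [by move=> ?; apply: Ga; left|by move=> ?; apply: Gb; left|].
    by move=> y yab; have [//|/=] := Gab y yab; lra.
  suff [-> ->] : a = s /\ b = t by [].
  split; apply/eqP; rewrite eq_le; apply/andP; split; rewrite leNgt; apply/negP => ?; lra.
Qed.

(** Each component of the maximal loop set [G] is collapsed: [F x] is the last point outside [G] up
    to [x]. The jumps of [F] do not break continuity, since [g] agrees at both ends of a
    component. *)
Lemma path_loop_free (g : R -> D) : continuous g -> exists g' : R -> D,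
  [/\ continuous g', g' 0 = g 0, g' 1 = g 1, loop_free g' &
      [/\ forall t, exists s, g' t = g s, forall t, t <= 0 -> g' t = g' 0 &
          forall t, 1 <= t -> g' t = g' 1]].
Proof.
move=> cg; have /continuous_pathP cgP := cg.
have [G [oO G01 Ggap Gmax]] := maximal_loop_set cg.
have cO : closed (~` G) by exact: open_closedC.
have nO0 : ~ G 0 by move=> /G01 /=; rewrite ltxx.
have nO1 : ~ G 1 by move=> /G01 /=; rewrite ltxx andbF.
have /choice[F HF] : forall x, exists m, 0 <= x -> [/\ ~ G m, 0 <= m, m <= x &
    forall y, ~ G y -> y <= x -> y <= m].
  move=> x; have [x0|x0] := leP 0 x; last by exists 0; lra.
  have [m [Gm m0 mx mmax]] := closed_last cO nO0 x0.
  by exists m.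
(* The component around [x] ends at some [b] before [y], where [g] has the same value as at [F x];
   so both values can be compared at [b] and [F y], which lie between [x] and [y]. *)
have Fgap x y : 0 <= x -> x <= y -> F x <> F y ->
    exists2 b, x <= b <= y & g (F x) = g b /\ x <= F y.
  move=> x0 xy Fxy; have y0 : 0 <= y by lra.
  have [Gx Fx0 Fxx Fxmax] := HF x x0; have [Gy Fy0 Fyy Fymax] := HF y y0.
  have xFy : x <= F y.
    rewrite leNgt; apply/negP => Fyx; apply: Fxy; apply/eqP.
    by rewrite eq_le Fymax ?Fxmax //; lra.
  have [b [Gb bFy xb bmin]] := closed_first cO Gy xFy.
  exists b; first lra; split => //.
  have : F x <= b by lra.
  rewrite le_eqVlt => /orP[/eqP -> //|Fxb]; apply: Ggap => // z /andP[z1 z2].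
  apply: contrapT => nOz; have [zx|xz] := leP z x; first by have := Fxmax _ nOz zx; lra.
  by have := bmin _ nOz (ltW xz); lra.
have F0 : F 0 = 0.
  by have [_ h1 h2 _] := HF 0 (lexx 0); apply/eqP; rewrite eq_le h1 h2.
have F1 : F 1 = 1.
  have [_ h1 h2 h3] := HF 1 ler01; apply/eqP; rewrite eq_le h2 /=.
  exact: h3.
exists (fun t => g (F (clamp t))); split.
- apply/continuous_pathP => t e e0.
  have [d d0 hd] := cgP (clamp t) (e / 2) ltac:(lra).
  have key x y : 0 <= x -> x <= y -> `|clamp t - x| < d -> `|clamp t - y| < d ->
      mdist (g (F x)) (g (F y)) < e.
    move=> x0 xy; rewrite !ltr_norml => tx ty.
    have [->|Fxy] := eqVneq (F x) (F y); first by rewrite mdistxx.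
    have [b xby [-> xFy]] := Fgap x y x0 xy (elimN eqP Fxy).
    have [_ _ Fyy _] := HF y (le_trans x0 xy).
    have gb : mdist (g (clamp t)) (g b) < e / 2 by apply: hd; rewrite ltr_norml; lra.
    have gFy : mdist (g (clamp t)) (g (F y)) < e / 2 by apply: hd; rewrite ltr_norml; lra.
    by have := metric_triangle (g b) (g (clamp t)) (g (F y)); rewrite (metric_sym (g b) (g (clamp t))); lra.
  exists d => // s ts.
  have cts : `|clamp t - clamp s| < d by exact: le_lt_trans (clamp_lipschitz _ _) ts.
  have ctt : `|clamp t - clamp t| < d by rewrite subrr normr0.
  have /andP[t0 _] := clamp_itv t; have /andP[s0 _] := clamp_itv s.
  have [st|/ltW st] := leP (clamp t) (clamp s); first exact: key.
  by rewrite metric_sym; exact: key.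
- by rewrite clamp_le0 // F0.
- by rewrite clamp_ge1 // F1.
- move=> s u t su ut.
  have /andP[s0 s1] := clamp_itv s; have /andP[u0 u1] := clamp_itv u.
  have /andP[t0 t1] := clamp_itv t.
  have := le_clamp su; have := le_clamp ut.
  move: (clamp s) (clamp u) (clamp t) s0 s1 u0 u1 t0 t1 => {su ut}x y z x0 x1 y0 y1 z0 z1 yz xy.
  have [Gx Fx0 Fxx Fxmax] := HF x x0; have [Gy Fy0 Fyy Fymax] := HF y y0.
  have [Gz Fz0 Fzz Fzmax] := HF z z0.
  have Fxy : F x <= F y by apply: Fymax => //; lra.
  have Fyz : F y <= F z by apply: Fzmax => //; lra.
  move=> gxz; have [->//|Fxy'] := eqVneq (F x) (F y).
  have [->//|Fyz'] := eqVneq (F y) (F z).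
  have FFxy : F x < F y by rewrite lt_neqAle Fxy' Fxy.
  have FFyz : F y < F z by rewrite lt_neqAle Fyz' Fyz.
  case: Gy; apply: (Gmax (F x) (F z)) => //; lra.
- split=> t; first by exists (F (clamp t)).
  + by move=> t0; rewrite !clamp_le0.
  + by move=> t1; rewrite !clamp_ge1.
Qed.

(** Pauses are removed by a change of time. The distance [m k t] from [x k] to the path up to time
    [t] is nonincreasing in [t]; as the [x k] are dense in the path, the weighted sum [S] drops
    exactly when [g] moves, and [g] is reparametrized by its normalization [W]. *)
Lemma loop_free_arc (g : R -> D) : continuous g -> loop_free g -> g 0 <> g 1 ->
  (forall t, t <= 0 -> g t = g 0) -> (forall t, 1 <= t -> g t = g 1) ->
  exists a : R -> D, [/\ continuous a, a 0 = g 0, a 1 = g 1,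
    forall s t, 0 <= s <= 1 -> 0 <= t <= 1 -> a s = a t -> s = t &
    forall t, exists s, a t = g s].
Proof.
move=> cg lf g01 g0 g1; have /continuous_pathP cgP := cg.
(* Positions at rational times; codes of no rational give [g 0]. *)
pose x k := g (if unpickle k is Some r then ratr r else 0).
pose A k t := [set mdist (x k) (g s) | s in [set s | s <= t]].
pose m k t := inf (A k t).
have lbA k t : has_lbound (A k t) by exists 0 => _ [s _ <-]; exact: mdist_ge0.
have A0 k t : A k t !=set0 by exists (mdist (x k) (g t)), t => /=.
have m_le k t s : s <= t -> m k t <= mdist (x k) (g s).
  by move=> st; apply: ge_inf => //; exists s.
have m_ge k t b : (forall s, s <= t -> b <= mdist (x k) (g s)) -> b <= m k t.
  by move=> h; apply: lb_le_inf => // _ [s /h hs <-].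
have m_ge0 k t : 0 <= m k t by apply: m_ge => s _; exact: mdist_ge0.
have m_mono k s t : s <= t -> m k t <= m k s.
  by move=> st; apply: m_ge => u us; apply: m_le; lra.
(* Since [g] equals [g 0] at negative times, [m k t] is at most the distance from [x k] to [g 0];
   the denominator thus brings the terms below [2 ^- k.+1]. *)
pose c k : R := 2 ^- k.+1 / (1 + mdist (x k) (g 0)).
have c0 k : 0 < c k.
  by rewrite divr_gt0 ?invr_gt0 ?exprn_gt0 // ltr_pwDl // mdist_ge0.
have c2 k : c k <= 2 ^- k.+1.
  by rewrite ler_pdivrMr ?ler_peMr ?invr_ge0 ?exprn_ge0 // ?ltr_pwDl ?lerDl // mdist_ge0.
have cm2 k t : 0 <= c k * m k t <= 2 ^- k.+1.
  apply/andP; split; first by apply: mulr_ge0 => //; exact: ltW.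
  rewrite /c mulrAC ler_pdivrMr ?ltr_pwDl ?mdist_ge0 //.
  rewrite ler_wpM2l ?invr_ge0 ?exprn_ge0 //.
  have : m k t <= mdist (x k) (g (Num.min 0 t)) by apply: m_le; rewrite ge_min lexx orbT.
  by rewrite g0 ?ge_min ?lexx //; lra.
have [S [Sle Slt]] := weighted_sum cm2.
have Smono s t : s <= t -> S t <= S s.
  move=> st; rewrite -[S s]addr0; apply: Sle => // k.
  by rewrite mul0r addr0 ler_pM2l // m_mono.
have Scst s t : s <= t -> g s = g t -> S s = S t.
  move=> st gst; apply/eqP; rewrite eq_le; apply/andP; split; last exact: Smono.
  rewrite -[S t]addr0; apply: Sle => // k.
  rewrite mul0r addr0 ler_pM2l //; apply: m_ge => u ut.
  have [us|su] := leP u s; first exact: m_le.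
  by rewrite (lf s u t) ?m_le //; lra.
have Sstrict s t : s <= t -> g s <> g t -> S t < S s.
  move=> st gst; apply: Slt => [k|]; first by rewrite ler_pM2l // m_mono.
  (* This compact set is the whole path up to time [s], as [g] is constant before 0. It misses [g t]
     because [g] has no loops, so an [x k] close to [g t] detects the move. *)
  pose K := g @` `[Num.min 0 s, s].
  have cK : closed K.
    apply: compact_closed; first exact: metric_hausdorff.
    apply: continuous_compact; last exact: segment_compact.
    exact: continuous_subspaceT.
  have Ku u : u <= s -> K (g u).
    move=> us; have [mu|um] := leP (Num.min 0 s) u.
      by exists u => //=; rewrite in_itv /= mu.
    have m0 : Num.min 0 s <= 0 by rewrite ge_min lexx.
    exists (Num.min 0 s); first by rewrite /= in_itv /= lexx ge_min lexx orbT.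
    by rewrite !g0 //; lra.
  have /nbhs_mdistE[r r0 rK] : nbhs (g t) (~` K).
    apply: open_nbhs_nbhs; split; first exact: closed_openC.
    move=> [u]; rewrite /= in_itv /= => /andP[_ us] gut.
    by apply: gst; rewrite -gut -(lf u s t) // gut.
  have [d d0 hd] := cgP t (r / 2) ltac:(lra).
  have [|z [/interior_subset tq [q _ qE]]] := @dense_rat R (ball t d)° _ (open_interior _).
    by exists t; exact: nbhsx_ballx.
  exists (pickle q); rewrite ltr_pM2l //.
  have qt : mdist (g t) (g (ratr q)) < r / 2 by apply: hd; rewrite qE.
  have xq : x (pickle q) = g (ratr q) by rewrite /x pickleK.
  apply: (@lt_le_trans _ _ (r / 2)).
    by apply: le_lt_trans (m_le _ _ _ (lexx t)) _; rewrite xq metric_sym.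
  apply: m_ge => u us; rewrite xq leNgt; apply/negP => qu.
  apply: (rK (g u)); last exact: Ku.
  by have := metric_triangle (g t) (g (ratr q)) (g u); lra.
have Scont : continuous S.
  move=> t U /nbhs_ballP[e /= e0 eU]; apply/nbhs_ballP.
  have [d d0 hd] := cgP t (e / 3) ltac:(lra).
  exists d => // s /= ts; apply: eU; rewrite /ball /=.
  suff key u v : u <= v -> `|t - u| < d -> `|t - v| < d -> S u <= S v + 2 * (e / 3).
    have tt : `|t - t| < d by rewrite subrr normr0.
    rewrite ltr_norml; have [st|/ltW st] := leP s t.
      by have := Smono _ _ st; have := key _ _ st ts tt; lra.
    by have := Smono _ _ st; have := key _ _ st tt ts; lra.
  move=> uv tu tv; apply: Sle => [|k]; first lra.
  have : m k u <= m k v + 2 * (e / 3).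
    rewrite -lerBlDr; apply: m_ge => w wv; rewrite lerBlDr.
    have [wu|uw] := leP w u; first by have := m_le k u w wu; lra.
    have tw : `|t - w| < d by move: tu tv; rewrite !ltr_norml; lra.
    have := m_le k u u (lexx u); have := hd _ tu; have := hd _ tw.
    have := metric_triangle (x k) (g w) (g u); have := metric_triangle (g w) (g t) (g u).
    by rewrite (metric_sym (g w) (g t)); lra.
  move=> mle; apply: (@le_trans _ _ (c k * (m k v + 2 * (e / 3)))).
    by rewrite ler_pM2l.
  by rewrite mulrDr lerD2l [leRHS]mulrC ler_pM2r ?c2 //; lra.
have S10 : S 1 < S 0 by apply: Sstrict.
pose W t := (S 0 - S t) / (S 0 - S 1).
have W0 : W 0 = 0 by rewrite /W subrr mul0r.
have W1 : W 1 = 1 by rewrite /W divff // subr_eq0 gt_eqF.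
have Wcont : continuous W.
  move=> t; apply: cvgM; last exact: cvg_cst.
  by apply: cvgB; [exact: cvg_cst|exact: Scont].
have Wg s t : W s = W t <-> g s = g t.
  have -> : (W s = W t) = (S s = S t).
    rewrite /W propeqE; split => [|->//].
    have SS : (S 0 - S 1)^-1 != 0 by rewrite invr_eq0 subr_eq0 gt_eqF.
    by move=> /(mulIf SS) /addrI /oppr_inj.
  split => [Sst|gst].
    apply: contrapT => gst; have [st|/ltW st] := leP s t.
      by have := Sstrict _ _ st gst; rewrite Sst ltxx.
    by have := Sstrict _ _ st (fun H => gst (esym H)); rewrite Sst ltxx.
  have [st|/ltW st] := leP s t; first exact: Scst.
  by apply/esym; exact: Scst.
have /choice[T HT] : forall u, exists t, 0 <= t <= 1 /\ W t = clamp u.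
  move=> u; have [|t] := @IVT R W 0 1 (clamp u) ler01 (continuous_subspaceT Wcont).
    by rewrite W0 W1 min_l ?max_r ?clamp_itv.
  by rewrite in_itv /= => t01 Wt; exists t.
exists (fun u => g (T u)); split.
- apply/continuous_pathP => u e e0.
  (* The right inverse [T] of [W] may jump. Continuity of its composite with [g] holds because [W]
     maps the compact set [C] of times with far values to a closed set that misses [clamp u]. *)
  pose C := `[0, 1]%classic `&` [set t | e <= mdist (g (T u)) (g t)].
  have cC : compact C.
    apply: compact_closedI; first exact: segment_compact.
    rewrite (_ : [set t | _] = ~` [set t | mdist (g (T u)) (g t) < e]); last first.
      by apply/seteqP; split => t /=; [rewrite leNgt => /negP|move/negP; rewrite -leNgt].
    apply: open_closedC.
    rewrite openE => t /= tlt; apply/nbhs_ballP.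
    have [d d0 hd] := cgP t (e - mdist (g (T u)) (g t)) ltac:(lra).
    exists d => // s /= /hd; have := metric_triangle (g (T u)) (g t) (g s); lra.
  have cWC : closed (W @` C).
    apply: compact_closed; first exact: Rhausdorff.
    by apply: continuous_compact => //; exact: continuous_subspaceT.
  have : nbhs (clamp u) (~` (W @` C)).
    apply: open_nbhs_nbhs; split; first exact: closed_openC.
    move=> [t [_ /= te]]; have [_ <-] := HT u => /Wg gtu.
    by move: te; rewrite gtu mdistxx; lra.
  move/(clamp_continuous)/nbhs_ballP => [d d0 hd]; exists d => // s us.
  rewrite ltNge; apply/negP => es; apply: (hd s us).
  by have [Ts <-] := HT s; exists (T s) => //; split => //=; rewrite in_itv.
- by apply/Wg; have [_ ->] := HT 0; rewrite W0 clamp_le0.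
- by apply/Wg; have [_ ->] := HT 1; rewrite W1 clamp_ge1.
- move=> s t s01 t01 /Wg; have [_ ->] := HT s; have [_ ->] := HT t.
  by rewrite !clamp_id.
- by move=> t; exists (T t).
Qed.

Definition arc (a : R -> D) (p q : D) := [/\ continuous a, a 0 = p, a 1 = q &
  forall s t, 0 <= s <= 1 -> 0 <= t <= 1 -> a s = a t -> s = t].

Lemma path_arc (g : R -> D) (p q : D) : continuous g -> g 0 = p -> g 1 = q ->
  p <> q -> exists2 a, arc a p q & forall t, exists s, a t = g s.
Proof.
move=> cg g0 g1 pq; have [g' [cg' g'0 g'1 lf [g'g gl gr]]] := path_loop_free cg.
have pq' : g' 0 <> g' 1 by rewrite g'0 g'1 g0 g1.
have [a [ca a0 a1 ainj ag]] := loop_free_arc cg' lf pq' gl gr.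
exists a; first by split; rewrite ?a0 ?a1 ?g'0 ?g'1.
by move=> t; have [s ->] := ag t; exact: g'g.
Qed.

End loop_erasure.

(** * Uniqueness of arcs in dendrites *)

(** A continuous map from a compact set to a Hausdorff space is closed, and preimages under [k] are
    images under [h]. *)
Lemma compact_inverse_continuous (X T : topologicalType) (A : set X) (h : X -> T)
    (k : T -> X) : compact A -> hausdorff_space T -> {within A, continuous h} ->
  (forall x, A x -> k (h x) = x) -> {within h @` A, continuous k}.
Proof.
move=> cA hT ch kh; apply/continuous_closedP => C cC.
apply/closed_subspaceP; exists (h @` (A `&` C)).
  apply: compact_closed => //; apply: continuous_compact.
    by apply: continuous_subspaceW ch; exact: subIsetl.
  exact: compact_closedI.
apply/seteqP; split => s.
  move=> [[x [Ax Cx] <-] _]; split; last by exists x.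
  by rewrite /preimage /= /from_subspace kh.
by move=> [+ [x Ax xs]]; rewrite /preimage /= /from_subspace -xs kh // => Cx; split; exists x.
Qed.

Section circle.
Context {R : realType} {D : metricType R}.

Lemma compact_unit_circle : compact (@unit_circle R).
Proof.
apply: (@subclosed_compact _ _ (`[(-1 : R), 1]%classic `*` `[(-1 : R), 1]%classic)).
- rewrite (_ : @unit_circle R = (fun z : R * R => z.1 ^+ 2 + z.2 ^+ 2) @^-1` [set 1]) //.
  apply: preimage_closed; last exact: closed_eq.
  move=> z _; apply: (@cvgD _ R); apply: cvgM; (exact: cvg_fst) || (exact: cvg_snd).
- by apply: compact_setX; exact: segment_compact.
- move=> [x y]; rewrite /unit_circle /= => xy.
  by split; rewrite /= in_itv /=; nra.
Qed.

(* The upper half circle is parametrized by its abscissa through one arc, the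
   lower half through the other. *)
Lemma arcs_simple_closed_curve (a b : R -> D) (p q : D) : arc a p q -> arc b p q ->
  (forall s t, 0 < s < 1 -> 0 <= t <= 1 -> a s <> b t) ->
  exists S : set D, simple_closed_curve R S.
Proof.
move=> [ca a0 a1 ainj] [cb b0 b1 binj] ab.
pose pos (z : R * R) : R := (z.1 + 1) / 2.
pose h (z : R * R) := if 0 <= z.2 then a (pos z) else b (pos z).
have cpos : continuous pos.
  by move=> z; apply: cvgM; [apply: cvgD; [exact: cvg_fst|exact: cvg_cst]|exact: cvg_cst].
have posI z : @unit_circle R z -> 0 <= pos z <= 1.
  by case: z => x y; rewrite /unit_circle /pos /= => xy; nra.
pose A1 := @unit_circle R `&` [set z | 0 <= z.2].
pose A2 := @unit_circle R `&` [set z | z.2 <= 0].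
have cC : closed (@unit_circle R).
  by apply: compact_closed compact_unit_circle; exact: norm_hausdorff.
have cA1 : closed A1.
  apply: closedI => //.
  apply: (@preimage_closed _ _ snd [set y : R | 0 <= y]); last exact: closed_ge.
  by move=> z _; exact: cvg_snd.
have cA2 : closed A2.
  apply: closedI => //.
  apply: (@preimage_closed _ _ snd [set y : R | y <= 0]); last exact: closed_le.
  by move=> z _; exact: cvg_snd.
have A12 : A1 `|` A2 = @unit_circle R.
  apply/seteqP; split => z; first by move=> [[]|[]].
  by move=> Cz; have [z0|/ltW z0] := leP 0 z.2; [left|right].
have ends z : @unit_circle R z -> z.2 = 0 -> pos z = 0 \/ pos z = 1.
  case: z => x y; rewrite /unit_circle /pos /= => + y0; rewrite y0 => x1.
  have : (x - 1) * (x + 1) = 0 by nra.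
  by move/eqP; rewrite mulf_eq0 => /orP[] /eqP xx; [right|left]; lra.
have ch : {within @unit_circle R, continuous h}.
  rewrite -A12; apply: withinU_continuous => //.
  - apply: (@subspace_eq_continuous _ A1 _ (a \o pos)).
      by move=> z; rewrite inE => -[_ /= z0]; rewrite /from_subspace /h ifT.
    apply: continuous_subspaceT => z.
    by apply: continuous_comp; [exact: cpos|exact: ca].
  - apply: (@subspace_eq_continuous _ A2 _ (b \o pos)).
      move=> z; rewrite inE => -[Cz /=]; rewrite le_eqVlt => /orP[/eqP z0|z0].
        rewrite /from_subspace /= /h ifT ?z0 //; case: (ends z Cz z0) => ->; by rewrite ?a0 ?b0 ?a1 ?b1.
      by rewrite /from_subspace /= /h ifF // leNgt z0.
    apply: continuous_subspaceT => z.
    by apply: continuous_comp; [exact: cpos|exact: cb].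
have mixed z w : @unit_circle R z -> @unit_circle R w -> w.2 < 0 -> a (pos z) <> b (pos w).
  move=> Cz Cw w0 azbw.
  have w01 : 0 < pos w < 1.
    by move: Cw w0; case: w {azbw} => x y; rewrite /unit_circle /pos /= => xy y0; nra.
  have := posI z Cz; have := posI w Cw => w01' z01.
  have [z0|z0] := eqVneq (pos z) 0.
    by have := binj 0 (pos w) ltac:(lra) w01' ltac:(by rewrite b0 -azbw z0 a0); lra.
  have [z1|z1] := eqVneq (pos z) 1.
    by have := binj 1 (pos w) ltac:(lra) w01' ltac:(by rewrite b1 -azbw z1 a1); lra.
  by apply: (ab (pos z) (pos w)) => //; move: z01; rewrite !le_eqVlt eq_sym (negbTE z0) (negbTE z1).
have hinj z w : @unit_circle R z -> @unit_circle R w -> h z = h w -> z = w.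
  move=> Cz Cw; rewrite /h; case: (leP 0 z.2) => z0; case: (leP 0 w.2) => w0.
  - move/(ainj _ _ (posI z Cz) (posI w Cw)); move: Cz Cw z0 w0; case: z => x y; case: w => x' y'.
    rewrite /unit_circle /pos /= => xy xy' y0 y'0 xx'; have {xx'} xx' : x = x' by lra.
    rewrite xx' in xy *; congr pair; apply/eqP; rewrite -(eqrXn2 (n := 2)) //; apply/eqP; lra.
  - by move/(mixed z w Cz Cw w0).
  - by move/esym/(mixed w z Cw Cz z0).
  - move/(binj _ _ (posI z Cz) (posI w Cw)); move: Cz Cw z0 w0; case: z => x y; case: w => x' y'.
    rewrite /unit_circle /pos /= => xy xy' y0 y'0 xx'; have {xx'} xx' : x = x' by lra.
    rewrite xx' in xy *; congr pair; apply/oppr_inj/eqP; rewrite -(eqrXn2 (n := 2)) ?oppr_ge0 ?ltW //.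
    by apply/eqP; rewrite !sqrrN; lra.
have /choice[k Hk] : forall s, exists z, (exists2 w, @unit_circle R w & h w = s) ->
    @unit_circle R z /\ h z = s.
  by move=> s; have [[w Cw ws]|nw] := pselect (exists2 w, @unit_circle R w & h w = s); [exists w|exists 0].
have kh z : @unit_circle R z -> k (h z) = z.
  by move=> Cz; have [|Ck hk] := Hk (h z); [exists z|exact: hinj].
exists (h @` @unit_circle R), h, k; split => //.
- by apply: compact_inverse_continuous kh => //; [exact: compact_unit_circle|exact: metric_hausdorff].
- by move=> s [z Cz <-]; rewrite kh.
- split; first by move=> z; rewrite inE; exact: kh.
  by move=> s; rewrite inE => -[z Cz <-]; rewrite kh.
Qed.

End circle.

Section dendrites.
Context {R : realType} {D : metricType R}.

(** The negation means that [z] separates [p] from [q] or equals one of them, because the component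
    of a point outside the set is empty. *)
Definition linked (z p q : D) := connected_component (~` [set z]) p q.

Lemma linked_neq z p q : linked z p q -> p <> z /\ q <> z.
Proof.
move=> h; split; last exact: (connected_component_sub h).
exact: (connected_component_sub (connected_component_sym h)).
Qed.

Lemma linkedxx z p : p <> z -> linked z p p.
Proof. exact: connected_component_refl. Qed.

Lemma linked_sym z p q : linked z p q -> linked z q p.
Proof. exact: connected_component_sym. Qed.

Lemma linked_trans z q p r : linked z p q -> linked z q r -> linked z p r.
Proof. exact: connected_component_trans. Qed.

Lemma connected_linked (A : set D) z p q : connected A -> A p -> A q -> ~ A z ->
  linked z p q.
Proof. by move=> cA Ap Aq nAz; exists A => //; split => // y Ay yz; apply: nAz; rewrite -yz. Qed.

Lemma path_connected_image (a : R -> D) s t : continuous a -> connected (a @` `[s, t]).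
Proof.
move=> ca; apply: connected_continuous_connected; first exact: segment_connected.
exact: continuous_subspaceT.
Qed.

Lemma path_compact_image (a : R -> D) s t : continuous a -> compact (a @` `[s, t]).
Proof.
move=> ca; apply: continuous_compact; last exact: segment_compact.
exact: continuous_subspaceT.
Qed.

Hypothesis Dd : dendrite D.

Let Dc : compact [set: D]. Proof. by have [[]] := Dd. Qed.
Let Dlc : locally_connected D. Proof. by have [] := Dd. Qed.
Let Dconn : connected [set: D]. Proof. by have [[]] := Dd. Qed.

Lemma linked_open z p : open [set q | linked z p q].
Proof.
rewrite openE => q /= pq.
have oz : open (~` [set z]).
  by apply: closed_openC; apply: accessible_closed_set1; exact: hausdorff_accessible (@metric_hausdorff _ _).
have [V [oV cV Vq Vz]] := Dlc (open_nbhs_nbhs (conj oz (linked_neq pq).2)).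
apply: filterS (open_nbhs_nbhs (conj oV Vq)) => r Vr.
by apply: linked_trans pq _; apply: (connected_linked cV) => // /Vz; apply.
Qed.

Lemma dendrite_has_arc p q : p <> q -> exists a : R -> D, arc a p q.
Proof.
move=> pq; have [g [cg g0 g1 _]] := open_connected_path Dc Dlc openT Dconn (p := p) (q := q) I I.
by have [a] := path_arc cg g0 g1 pq; exists a.
Qed.

(** A path [b] from [p] to [q] off [a t] leaves the first part [A1] of the arc for the last time at
    [u1] and next meets the second part [A2] at [u2]. In between it avoids the arc, so with its
    loops erased it closes a simple closed curve with the piece of the arc through [a t]. *)
Lemma arc_separated (a : R -> D) p q t : arc a p q -> 0 < t < 1 -> ~ linked (a t) p q.
Proof.
move=> [ca a0 a1 ainj] t01 apq.
have [b [cb b0 b1 bC]] := open_connected_path Dc Dlc (@linked_open (a t) p)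
  (@component_connected _ _ _) (linkedxx (linked_neq apq).1) apq.
have bat u : b u <> a t by have [] := linked_neq (bC u).
pose A1 := a @` `[0, t]; pose A2 := a @` `[t, 1].
have cA s s' : closed (b @^-1` (a @` `[s, s'])).
  apply: preimage_closed; first by move=> u _; exact: cb.
  by apply: compact_closed; [exact: metric_hausdorff|exact: path_compact_image].
have A1b0 : (b @^-1` A1) 0 by exists 0; rewrite ?a0 ?b0 //= in_itv /=; lra.
have A2b1 : (b @^-1` A2) 1 by exists 1; rewrite ?a1 ?b1 //= in_itv /=; lra.
have [u1 [A1u u10 u11 u1max]] := closed_last (cA 0 t) A1b0 ler01.
have [u2 [A2u u21 u12 u2min]] := closed_first (cA t 1) A2b1 u11.
case: (A1u) => s1 /=; rewrite in_itv /= => s1t as1.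
case: (A2u) => s2 /=; rewrite in_itv /= => s2t as2.
have s1t' : s1 < t.
  by rewrite lt_neqAle; apply/andP; split; [apply/eqP => s1t'; apply: (bat u1); rewrite -as1 s1t'|lra].
have s2t' : t < s2.
  by rewrite lt_neqAle; apply/andP; split; [apply/eqP => s2t'; apply: (bat u2); rewrite -as2 -s2t'|lra].
have u12' : u1 < u2.
  rewrite lt_neqAle u12 andbT; apply/eqP => u12'.
  have : s1 = s2 by apply: ainj; [lra|lra|rewrite as1 as2 u12'].
  lra.
have bout u s : u1 < u < u2 -> 0 <= s <= 1 -> b u <> a s.
  move=> u12u s01 bas; have [st|ts] := leP s t.
    by have := u1max u ltac:(by exists s; rewrite ?bas //= in_itv /=; lra); lra.
  by have := u2min u ltac:(by exists s; rewrite ?bas //= in_itv /=; lra); lra.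
pose g v := b (u1 + (u2 - u1) * clamp v).
have cg : continuous g.
  move=> v; apply: (@continuous_comp _ _ _ (fun v => u1 + (u2 - u1) * clamp v)); last exact: cb.
  apply: cvgD; first exact: cvg_cst.
  by apply: cvgM; [exact: cvg_cst|exact: clamp_continuous].
have g0 : g 0 = a s1 by rewrite /g clamp_le0 // mulr0 addr0.
have g1 : g 1 = a s2 by rewrite /g clamp_ge1 // mulr1 addrC subrK.
have as12 : a s1 <> a s2 by move/ainj => s12; have := s12 ltac:(lra) ltac:(lra); lra.
have [c cc cg'] := path_arc cg g0 g1 as12.
have [_ _ /(_ _)] := Dd; apply.
apply: (arcs_simple_closed_curve (a := c) (b := fun v => a (s1 + (s2 - s1) * v)) cc).
  split.
  - move=> v; apply: (@continuous_comp _ _ _ (fun v => s1 + (s2 - s1) * v)); last exact: ca.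
    by apply: cvgD; [exact: cvg_cst|exact: mulrl_continuous].
  - by rewrite mulr0 addr0.
  - by rewrite mulr1 addrC subrK.
  - move=> s s' s01 s'01 /ainj H.
    have e v : 0 <= v <= 1 -> 0 <= s1 + (s2 - s1) * v <= 1 by move=> v01; nra.
    by have /addrI := H (e _ s01) (e _ s'01); apply: mulfI; rewrite subr_eq0 gt_eqF //; lra.
case: cc => _ c0 c1 cinj.
move=> s s' s01 s'01; have [w cw] := cg' s; rewrite cw => gw.
have w01 := clamp_itv w.
have [w0|w0] := eqVneq (clamp w) 0.
  have : s = 0 by apply: cinj; [lra|lra|rewrite cw c0 /g w0 mulr0 addr0].
  lra.
have [w1|w1] := eqVneq (clamp w) 1.
  have : s = 1 by apply: cinj; [lra|lra|rewrite cw c1 /g w1 mulr1 addrC subrK].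
  lra.
have w0' : 0 < clamp w by rewrite lt_neqAle eq_sym w0; case/andP: w01.
have w1' : clamp w < 1 by rewrite lt_neqAle w1; case/andP: w01.
by apply: (bout (u1 + (u2 - u1) * clamp w) (s1 + (s2 - s1) * s')) gw; nra.
Qed.

Definition seg (p q : D) : set D := [set z | ~ linked z p q].

Lemma arc_seg (a : R -> D) p q : arc a p q -> a @` `[0, 1] = seg p q.
Proof.
move=> aa; have [ca a0 a1 ainj] := aa; apply/seteqP; split => [_ [t /= + <-]|z nz].
  rewrite in_itv /= => /andP[t0 t1].
  have [->|t0'] := eqVneq t 0; first by rewrite a0 => /linked_neq[].
  have [->|t1'] := eqVneq t 1; first by rewrite a1 => /linked_neq[].
  by apply: (arc_separated aa); rewrite !lt_neqAle eq_sym t0' t0 t1' t1.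
apply: contrapT => az; apply: nz; apply: (connected_linked _ _ _ az).
- exact: path_connected_image.
- by exists 0 => //=; rewrite in_itv /= lexx ler01.
- by exists 1 => //=; rewrite in_itv /= lexx ler01.
Qed.

End dendrites.

(** * Segments and germs of maps at a fixed point *)

Section segments.
Context {R : realType} {D : metricType R}.
Hypothesis Dd : dendrite D.
Implicit Types (a : R -> D) (g h : D -> D).

Lemma connected_seg_sub (A : set D) p q : connected A -> A p -> A q -> seg p q `<=` A.
Proof.
by move=> cA Ap Aq z zpq; apply: contrapT => nAz; apply: zpq; exact: connected_linked nAz.
Qed.

Lemma segl (p q : D) : seg p q p. Proof. by move=> /linked_neq[]. Qed.

Lemma segr (p q : D) : seg p q q. Proof. by move=> /linked_neq[]. Qed.

Lemma segxx (p z : D) : seg p p z -> z = p.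
Proof. by move=> zp; apply: contrapT => /nesym/linkedxx. Qed.

(** A point strictly between [a s] and [a t] that did not separate them would not separate [p] from
    [q] either, as the two outer pieces of the arc avoid it. *)
Lemma arc_image_seg a p q s t : arc a p q -> 0 <= s -> s <= t -> t <= 1 ->
  a @` `[s, t] = seg (a s) (a t).
Proof.
move=> aa s0 st t1; have [ca a0 a1 ainj] := aa; apply/seteqP; split; last first.
  apply: connected_seg_sub; first exact: path_connected_image.
    by exists s => //=; rewrite in_itv /= lexx.
  by exists t => //=; rewrite in_itv /= lexx andbT.
move=> _ [u /= + <-]; rewrite in_itv /= => /andP[su ut] ust.
have [us ut'] := linked_neq ust.
have us' : u != s by apply/eqP => us'; apply: us; rewrite us'.
have ut'' : u != t by apply/eqP => us''; apply: ut'; rewrite us''.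
have su' : s < u by rewrite lt_neqAle eq_sym us'.
have ut3 : u < t by rewrite lt_neqAle ut''.
have : (a @` `[0, 1]) (a u) by exists u => //=; rewrite in_itv /=; lra.
rewrite (arc_seg Dd aa); apply.
apply: (linked_trans (q := a s)).
  apply: (@connected_linked _ _ (a @` `[0, s])); first exact: path_connected_image.
  - by exists 0; rewrite //= in_itv /=; lra.
  - by exists s; rewrite //= in_itv /=; lra.
  - by move=> [v /=]; rewrite in_itv /= => vs /ainj H; have := H ltac:(lra) ltac:(lra); lra.
apply: linked_trans ust _.
apply: (@connected_linked _ _ (a @` `[t, 1])); first exact: path_connected_image.
- by exists t; rewrite //= in_itv /=; lra.
- by exists 1; rewrite //= in_itv /=; lra.
- by move=> [v /=]; rewrite in_itv /= => vs /ainj H; have := H ltac:(lra) ltac:(lra); lra.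
Qed.

Lemma seg_arcP a p q z : arc a p q -> seg p q z -> exists2 t, 0 <= t <= 1 & a t = z.
Proof.
by move=> aa; rewrite -(arc_seg Dd aa) => -[t /=]; rewrite in_itv /=; exists t.
Qed.

Lemma arc_seg0P a p q t z : arc a p q -> 0 <= t <= 1 ->
  seg p (a t) z <-> exists2 s, 0 <= s <= t & a s = z.
Proof.
move=> aa /andP[t0 t1]; have [_ a0 _ _] := aa.
rewrite -{1}a0 -(arc_image_seg aa (lexx 0) t0 t1).
by split => -[s /= st az]; exists s => //; move: st; rewrite in_itv.
Qed.

Lemma arc_linked a p q s t u : arc a p q -> 0 <= s <= 1 -> 0 <= t <= 1 ->
  0 <= u <= 1 -> (u < s /\ u < t) \/ (s < u /\ t < u) -> linked (a u) (a s) (a t).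
Proof.
move=> [ca _ _ ainj] s01 t01 u01.
wlog st : s t s01 t01 / s <= t.
  move=> H ust; have [st|/ltW ts] := leP s t; first exact: H.
  by apply: linked_sym; apply: H => //; lra.
move=> ust; apply: (@connected_linked _ _ (a @` `[s, t])).
- exact: path_connected_image.
- by exists s; rewrite //= in_itv /=; lra.
- by exists t; rewrite //= in_itv /=; lra.
- by move=> [v /=]; rewrite in_itv /= => vst /ainj H; have := H ltac:(lra) u01; lra.
Qed.

(** Here [seg e w y] reads: [y] lies between [e] and [w]. This and the following order facts become
    inequalities between parameters on one arc from [e]. *)
Lemma seg_between (e w y u : D) : seg e w y -> seg y w u -> seg e w u /\ seg e u y.
Proof.
have [->|/eqP ew] := eqVneq e w; first by move=> /segxx -> /segxx ->; split; exact: segl.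
have [a aa] := dendrite_has_arc Dd ew; have [_ a0 a1 _] := aa.
move=> /(seg_arcP aa)[c c01 <-].
rewrite -{1}a1 -(arc_image_seg aa); [|lra|lra|lra].
move=> [v /=]; rewrite in_itv /= => cv <-; split.
  by rewrite -(arc_seg Dd aa); exists v => //=; rewrite in_itv /=; lra.
by apply/(arc_seg0P _ aa); [lra|exists c => //; lra].
Qed.

Lemma seg_trans (e w y z : D) : seg e w y -> seg e y z -> seg e w z.
Proof.
have [->|/eqP ew] := eqVneq e w; first by move=> /segxx -> /segxx ->; exact: segl.
have [a aa] := dendrite_has_arc Dd ew.
move=> /(seg_arcP aa)[c c01 <-] /(arc_seg0P _ aa c01)[v vc <-].
by rewrite -(arc_seg Dd aa); exists v => //=; rewrite in_itv /=; lra.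
Qed.

Lemma seg_anti (e y z : D) : seg e y z -> seg e z y -> y = z.
Proof.
have [->|/eqP ey] := eqVneq e y; first by move=> /segxx ->.
have [a aa] := dendrite_has_arc Dd ey; have [_ _ a1 ainj] := aa.
move=> /(seg_arcP aa)[c c01 <-] /(arc_seg0P _ aa c01)[v vc]; rewrite -{1}a1.
by move=> /ainj H; have -> : c = 1 by have := H ltac:(lra) ltac:(lra); lra.
Qed.

Lemma seg_linked (e y u : D) : seg e y u -> u <> e -> linked e u y.
Proof.
have [->|/eqP ey] := eqVneq e y; first by move=> /segxx ->.
have [a aa] := dendrite_has_arc Dd ey; have [_ a0 a1 _] := aa.
move=> /(seg_arcP aa)[c c01 <-] ace; rewrite -{1}a0 -a1.
apply: (arc_linked aa); [lra|lra|lra|left].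
suff : 0 < c by lra.
rewrite lt_neqAle; apply/andP; split; last lra.
by apply/eqP => c0; apply: ace; rewrite -c0.
Qed.

Lemma connected_seg (p q : D) : connected (seg p q).
Proof.
have [->|/eqP pq] := eqVneq p q.
  rewrite (_ : seg q q = [set q]); first exact: connected1.
  by apply/seteqP; split => [z /segxx //|z ->]; exact: segl.
have [a aa] := dendrite_has_arc Dd pq; rewrite -(arc_seg Dd aa).
by apply: path_connected_image; case: aa.
Qed.

Lemma closed_seg (p q : D) : closed (seg p q).
Proof.
have hD : hausdorff_space D by exact: metric_hausdorff.
have [->|/eqP pq] := eqVneq p q.
  rewrite (_ : seg q q = [set q]); last first.
    by apply/seteqP; split => [z /segxx //|z ->]; exact: segl.
  by apply: compact_closed => //; exact: compact_set1.
have [a aa] := dendrite_has_arc Dd pq; rewrite -(arc_seg Dd aa).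
by apply: compact_closed => //; apply: path_compact_image; case: aa.
Qed.

(** The closed segment from [p] to [w] misses all [z'] near [z], and a small connected neighbourhood
    of [w], away from [z], extends the link to [w']. *)
Lemma linked_near (z p w : D) : linked z p w -> exists2 d : R, 0 < d &
  forall z' w', mdist z z' < d -> mdist w w' < d -> linked z' p w'.
Proof.
move=> zpw; have [_ wz] := linked_neq zpw; have [_ Dlc _] := Dd.
have /nbhs_mdistE[d1 d10 h1] : nbhs z (~` seg p w).
  by apply: open_nbhs_nbhs; split; [apply: closed_openC; exact: closed_seg|exact].
have zw0 : 0 < mdist z w by rewrite mdist_gt0; apply/eqP => /esym.
have /Dlc[V [oV cV Vw Vball]] : nbhs w [set y | mdist w y < mdist z w / 2].
  by apply/nbhs_mdistE; exists (mdist z w / 2) => //; lra.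
have /nbhs_mdistE[d2 d20 h2] : nbhs w V by exact: open_nbhs_nbhs.
pose m := Num.min (Num.min d1 d2) (mdist z w / 2).
have [m1 m2 m3] : [/\ m <= d1, m <= d2 & m <= mdist z w / 2].
  by split; rewrite !ge_min lexx ?orbT.
exists m => [|z' w' zz' ww']; first by rewrite !lt_min d10 d20; lra.
have nz' : ~ seg p w z' by apply: h1; lra.
apply: (linked_trans (q := w)); first by apply: contrapT => /nz'.
apply: (connected_linked cV) => //; first by apply: h2; lra.
move=> /Vball /=; have := metric_triangle z z' w; rewrite (metric_sym z' w); lra.
Qed.

Lemma arc_interior_cutpoint a p q t : arc a p q -> 0 < t < 1 -> cutpoint (a t).
Proof.
move=> aa t01; have napq := arc_separated Dd aa t01.
have [_ a0 a1 ainj] := aa.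
have pt : p <> a t by rewrite -a0 => /ainj H; have := H ltac:(lra) ltac:(lra); lra.
have qt : q <> a t by rewrite -a1 => /ainj H; have := H ltac:(lra) ltac:(lra); lra.
exists (connected_component (~` [set a t]) p), (connected_component (~` [set a t]) q).
split; [by exists p|by exists q|move=> pq; apply: napq].
by rewrite /linked pq; exact: linkedxx.
Qed.

Lemma not_cutpoint_linked (e p q : D) : ~ cutpoint e -> p <> e -> q <> e -> linked e p q.
Proof.
move=> nce pe qe; apply: contrapT => npq; apply: nce.
exists (connected_component (~` [set e]) p), (connected_component (~` [set e]) q).
split; [by exists p|by exists q|move=> pq; apply: npq].
by rewrite /linked pq; exact: linkedxx.
Qed.

End segments.

Section germs.
Context {R : realType} {D : metricType R}.
Hypothesis Dd : dendrite D.
Implicit Types (a : R -> D) (g h : D -> D) (e b z : D).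

Definition inward g e z := linked z e (g z).

(** The relation [separates z e (g z)] of the repelling condition, expressed by [linked]. *)
Definition outward g e z := [/\ z <> e, g z <> z & ~ linked z e (g z)].

Lemma separates_outward g e z : separates z e (g z) -> outward g e z.
Proof.
move=> [C1 [C2 [[p zp <-] [q zq <-] C12 ep gq]]].
have [_ ez] := linked_neq ep; have [_ gz] := linked_neq gq.
split => [/esym //|//|ezg]; apply: C12.
rewrite (same_connected_component ep) (same_connected_component gq).
exact: same_connected_component.
Qed.

Lemma inward_or_outward g e z : z <> e -> g z <> z -> inward g e z \/ outward g e z.
Proof. by move=> ze gz; have [|] := pselect (inward g e z); [left|right]. Qed.

Lemma outward_seg g e z y : outward g e z -> linked z (g z) y -> seg e y z.
Proof. by move=> [_ _ nl] zy ezy; apply: nl; apply: linked_trans ezy (linked_sym zy). Qed.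

Lemma inward_open g e a t : continuous g -> continuous a -> inward g e (a t) ->
  exists2 d : R, 0 < d & forall s, `|t - s| < d -> inward g e (a s).
Proof.
move=> cg ca /(linked_near Dd)[d d0 hd].
have /continuous_pathP caP := ca.
have /continuous_pathP cgaP : continuous (g \o a).
  by move=> s; apply: continuous_comp; [exact: ca|exact: cg].
have [d1 d10 h1] := caP t d d0; have [d2 d20 h2] := cgaP t d d0.
exists (Num.min d1 d2) => [|s]; first by rewrite lt_min d10.
by rewrite lt_min => /andP[/h1 s1 /h2 s2]; exact: hd.
Qed.

(** For [s] slightly below [t], the image of [a s] stays beyond [a t] and hence beyond [a s]. Only
    this side works: for [s] above [t] the image may branch off the arc at [a t]. *)
Lemma outward_left_open g e b a t : continuous g -> arc a e b -> 0 < t <= 1 ->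
  outward g e (a t) ->
  exists2 d : R, 0 < d & forall s, t - d < s -> s <= t -> 0 < s -> outward g e (a s).
Proof.
move=> cg aa t01 out; have [ca a0 a1 ainj] := aa; have [te gt nl] := out.
have gtC : nbhs (g (a t)) [set w | linked (a t) (g (a t)) w].
  by apply: open_nbhs_nbhs; split; [exact: linked_open|exact: linkedxx].
have /nbhs_ballP[d /= d0 hd] := ca t _ (cg (a t) _ gtC).
exists d => // s tds st s0.
have gsC : linked (a t) (g (a t)) (g (a s)) by apply: hd; rewrite /ball /= ltr_norml; lra.
have [->//|/eqP st'] := eqVneq s t.
have {}st : s < t by rewrite lt_neqAle; apply/andP; split => //; exact/eqP.
have est : linked (a t) e (a s).
  by rewrite -a0; apply: (arc_linked aa); lra.
have sseg : seg e (a t) (a s) by apply/(arc_seg0P Dd _ aa); [lra|exists s => //; lra].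
split.
- by rewrite -a0 => /ainj H; have := H ltac:(lra) ltac:(lra); lra.
- by move=> gs; apply: nl; apply: linked_trans est _; apply: linked_sym; rewrite -gs.
- by apply: (seg_trans Dd _ sseg); exact: outward_seg out gsC.
Qed.

(** Consider the supremum of the inward parameters. If inward there, inwardness would persist beyond
    it; if outward, it would have no inward parameters just below. *)
Lemma outward_down g e b a t0 : continuous g -> arc a e b -> 0 < t0 <= 1 ->
  outward g e (a t0) -> (forall t, 0 < t < t0 -> g (a t) <> a t) ->
  forall t, 0 < t <= t0 -> outward g e (a t).
Proof.
move=> cg aa t001 out nfix t1 t10; have [ca a0 a1 ainj] := aa.
have ne t : 0 < t <= 1 -> a t <> e.
  by move=> t01; rewrite -a0 => /ainj H; have := H ltac:(lra) ltac:(lra); lra.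
have nf t : 0 < t <= t0 -> g (a t) <> a t.
  move=> tt0; have [->|tt0'] := eqVneq t t0; first by case: out.
  have : t < t0 by rewrite lt_neqAle tt0'; case/andP: tt0.
  by move=> tt0''; apply: nfix; lra.
apply: contrapT => nout.
have in1 : inward g e (a t1).
  by case: (@inward_or_outward g e (a t1)) => //; [apply: ne; lra|exact: nf].
pose S := [set t | t <= t0 /\ inward g e (a t)].
have S1 : S t1 by split => //; lra.
have ubS : has_ubound S by exists t0 => t [].
have supS : has_sup S by split => //; exists t1.
have s1 : t1 <= sup S by exact: ub_le_sup.
have s0 : sup S <= t0 by apply: ge_sup; [exists t1|move=> t []].
have s01 : 0 < sup S <= 1 by lra.
case: (@inward_or_outward g e (a (sup S))); [by apply: ne|by apply: nf; lra| |].
- move=> ins; have [d d0 hd] := inward_open cg ca ins.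
  have [ss0|ss0] := eqVneq (sup S) t0; first by case: out => _ _; apply; rewrite -ss0.
  have ss0' : sup S < t0 by rewrite lt_neqAle ss0.
  pose m := Num.min (d / 2) (t0 - sup S).
  have m0 : 0 < m by rewrite lt_min; lra.
  have [m1 m2] : m <= d / 2 /\ m <= t0 - sup S by split; rewrite ge_min lexx ?orbT.
  have : sup S + m <= sup S.
    apply: ub_le_sup => //; split; first lra.
    by apply: hd; rewrite ltr_norml; lra.
  lra.
- move=> outs; have [d d0 hd] := outward_left_open cg aa s01 outs.
  have [t [tt0 int] dt] := sup_adherent d0 supS.
  have ts : t <= sup S by apply: ub_le_sup.
  have [tp|tn] := ltP 0 t; first by have [_ _ /(_ int)] := hd t dt ts tp.
  (* The bound by [t1] makes the parameter positive, as [S] may contain negative ones. *)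
  have [t' [t't0 int'] dt'] := sup_adherent (eps := Num.min d t1) ltac:(by rewrite lt_min; lra) supS.
  have [m1 m2] : Num.min d t1 <= d /\ Num.min d t1 <= t1 by split; rewrite ge_min lexx ?orbT.
  by have [_ _ /(_ int')] := hd t' ltac:(lra) ltac:(exact: ub_le_sup) ltac:(lra).
Qed.

(** Properties near the start of an arc, the starting point itself excluded. *)
Definition germ (P : R -> Prop) := exists2 d : R, 0 < d <= 1 & forall t, 0 < t <= d -> P t.

Lemma germI P Q : germ P -> germ Q -> germ (fun t => P t /\ Q t).
Proof.
move=> [d d01 hd] [d' d'01 hd'].
have [m1 m2] : Num.min d d' <= d /\ Num.min d d' <= d' by split; rewrite ge_min lexx ?orbT.
exists (Num.min d d'); first by rewrite lt_min; lra.
by move=> t t0; split; [apply: hd|apply: hd']; lra.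
Qed.

Lemma germ_mono (P Q : R -> Prop) : (forall t, 0 < t <= 1 -> P t -> Q t) -> germ P -> germ Q.
Proof. by move=> PQ [d d01 hd]; exists d => // t td; apply: PQ; [lra|exact: hd]. Qed.

Lemma germ_ex (P : R -> Prop) : germ P -> exists2 t, 0 < t <= 1 & P t.
Proof. by move=> [d d01 hd]; exists d => //; apply: hd; lra. Qed.

Lemma near_germ a e (U : set D) : continuous a -> a 0 = e -> nbhs e U ->
  germ (fun t => U (a t)).
Proof.
move=> ca a0; rewrite -a0 => /ca /nbhs_ballP[d /= d0 hd].
have [m1 m2] : Num.min (d / 2) 1 <= d / 2 /\ Num.min (d / 2) 1 <= 1.
  by split; rewrite ge_min lexx ?orbT.
exists (Num.min (d / 2) 1); first by rewrite lt_min; lra.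
by move=> t t0; apply: hd; rewrite /ball /= ltr_norml; lra.
Qed.

(** A single outward point spreads down to [e] by [outward_down]. *)
Lemma germ_dichotomy g e b a : continuous g -> arc a e b ->
  germ (fun t => g (a t) <> a t) ->
  germ (fun t => inward g e (a t)) \/ germ (fun t => outward g e (a t)).
Proof.
move=> cg aa [d d01 nf]; have [_ a0 _ ainj] := aa.
have [[t0 t0d out]|nout] := pselect (exists2 t, 0 < t <= d & outward g e (a t)).
  right; exists t0; first lra.
  by apply: (outward_down cg aa) => // [|t t0t]; [lra|apply: nf; lra].
left; exists d => // t td; case: (@inward_or_outward g e (a t)) => //.
- by rewrite -a0 => /ainj H; have := H ltac:(lra) ltac:(lra); lra.
- exact: nf.
- by move=> out; case: nout; exists t.
Qed.

Lemma arc_image_cover h e b a t y : continuous h -> h e = e -> arc a e b ->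
  0 <= t -> seg e (h (a t)) y -> exists2 v, 0 <= v <= t & h (a v) = y.
Proof.
move=> ch he [ca a0 _ _] t0 ey.
have cha : continuous (h \o a) by move=> s; apply: continuous_comp; [exact: ca|exact: ch].
have := connected_seg_sub (path_connected_image (s := 0) (t := t) cha) _ _ ey.
case.
- by exists 0; rewrite //= ?in_itv /= ?lexx // a0.
- by exists t; rewrite //= in_itv /= lexx andbT.
- by move=> v /=; rewrite in_itv /=; exists v.
Qed.

(** Since [h] pushes [a d] outward, it maps some earlier [a v] onto [a d]; then [g] sends [a d]
    beyond itself, hence beyond [a v]. *)
Lemma outward_comp g h e b a : continuous h -> h e = e -> arc a e b ->
  germ (fun t => outward g e (a t)) -> germ (fun t => outward h e (a t)) ->
  ~ germ (fun t => inward (g \o h) e (a t)).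
Proof.
move=> ch he aa gg gh /(germI (germI gg gh))[d d01 hd].
have [[gout [de hde hout]] _] := hd d ltac:(lra).
have [v vd hv] := arc_image_cover ch he aa (ltW (andP d01).1) hout.
have [_ a0 _ _] := aa.
have v0 : 0 < v.
  rewrite lt_neqAle; apply/andP; split; last by case/andP: vd.
  by apply/eqP => v0; apply: de; rewrite -hv -v0 a0 he.
have [_ inv] := hd v ltac:(lra); rewrite /inward /= hv in inv.
have [_ _ dseg] := gout; apply: (seg_trans Dd dseg _ inv).
by apply/(arc_seg0P Dd _ aa); [lra|exists v => //; lra].
Qed.

(** If the composite were outward, some point [u] beyond [a t] would satisfy [h u = a t] and
    [u = g (a v)]. Outwardness at [a v] puts [a v] before [a t], so [g] moves [a v] outward to
    [u]. *)
Lemma inward_comp g h e b a : ~ cutpoint e -> continuous g -> g e = e ->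
  continuous h -> h e = e -> arc a e b ->
  germ (fun t => inward g e (a t)) -> germ (fun t => inward h e (a t)) ->
  ~ germ (fun t => outward (h \o g) e (a t)).
Proof.
move=> nce cg ge ch he aa gg gh /(germI (germI gg gh))[d d01 hd].
have [_ [de _ dout]] := hd d ltac:(lra); rewrite /= in dout.
have [ca a0 _ ainj] := aa.
set w := g (a d) in dout.
have we : w <> e by move=> we; apply: dout; rewrite we he; apply: linkedxx => /esym.
(* As [e] is not a cutpoint, [w] and [a d] are linked off [e], hence off every [a t] close to [e];
   such a point lies between [e] and [w]. *)
have /(linked_near Dd)[r r0 hr] := not_cutpoint_linked nce we de.
have er : nbhs e [set z | mdist e z < r] by apply/nbhs_mdistE; exists r.
have [t [td tr]] : exists t, 0 < t < d /\ mdist e (a t) < r.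
  have [d' d'01 hd'] := near_germ ca a0 er.
  have [m1 m2] : Num.min (d / 2) d' <= d / 2 /\ Num.min (d / 2) d' <= d'.
    by split; rewrite ge_min lexx ?orbT.
  have m0 : 0 < Num.min (d / 2) d' by rewrite lt_min; lra.
  exists (Num.min (d / 2) d'); split; first lra.
  by apply: hd'; rewrite m0.
have wdt : linked (a t) w (a d) by apply: hr; rewrite ?mdistxx.
have seg_t : seg e (a d) (a t) by apply/(arc_seg0P Dd _ aa); [lra|exists t => //; lra].
have ewt : seg e w (a t) by move=> ew; apply: seg_t; exact: linked_trans wdt.
have [[_ int] _] := hd t ltac:(lra).
(* The image of [a t] under [h] is on the side of [e], that of [w] beyond [a d]; the connected image
   of the segment must pass through [a t]. *)
have [u segu hu] : exists2 u, seg (a t) w u & h u = a t.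
  apply: contrapT => nu; apply: (seg_trans Dd dout seg_t).
  apply: linked_trans int _.
  apply: (@connected_linked _ _ (h @` seg (a t) w)).
  - apply: connected_continuous_connected; first exact: connected_seg.
    exact: continuous_subspaceT.
  - by exists (a t) => //; exact: segl.
  - by exists w => //; exact: segr.
  - by move=> [u su hu]; apply: nu; exists u.
have [ewu eut] := seg_between Dd ewt segu.
have [v vd gv] := arc_image_cover cg ge aa (ltW (andP d01).1) ewu.
have te : a t <> e by rewrite -a0 => /ainj H; have := H ltac:(lra) ltac:(lra); lra.
have v0 : 0 < v.
  rewrite lt_neqAle; apply/andP; split; last by case/andP: vd.
  by apply/eqP => v0; apply: te; rewrite -hu -gv -v0 a0 ge he.
have [[inv _] [_ hgv outv]] := hd v ltac:(lra); rewrite /= gv hu in hgv outv.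
have vt : v <= t.
  rewrite leNgt; apply/negP => tv; apply: outv; rewrite -{1}a0.
  by apply: (arc_linked aa); lra.
move: inv; rewrite /inward gv; apply: (seg_trans Dd eut).
by apply/(arc_seg0P Dd _ aa); [lra|exists v => //; lra].
Qed.

Lemma iter_continuous g n : continuous g -> continuous (iter n g).
Proof.
move=> cg; elim: n => [|n IH] x; first exact: cvg_id.
by apply: (@continuous_comp _ _ _ (iter n g)); [exact: IH|exact: cg].
Qed.

Lemma iter_fixed g n e : g e = e -> iter n g e = e.
Proof. by move=> ge; elim: n => //= n ->. Qed.

(** Without periodic points nearby the dichotomy applies to every iterate, and [outward_comp]
    excludes one alternative. *)
Lemma outward_iter g e b a n : continuous g -> g e = e -> arc a e b ->
  germ (fun t => ~ periodic_point g (a t)) ->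
  germ (fun t => outward g e (a t)) -> germ (fun t => outward (iter n.+1 g) e (a t)).
Proof.
move=> cg ge aa np gout; elim: n => [//|n IH].
have ci m : continuous (iter m g) by exact: iter_continuous.
have nf : germ (fun t => iter n.+2 g (a t) <> a t).
  by apply: germ_mono np => t _ + ga; apply; exists n.+2.
have [gin|//] := germ_dichotomy (ci n.+2) aa nf.
by have /(_ gin) := outward_comp (ci n.+1) (iter_fixed n.+1 ge) aa gout IH.
Qed.

Lemma inward_iter g e b a n : ~ cutpoint e -> continuous g -> g e = e -> arc a e b ->
  germ (fun t => ~ periodic_point g (a t)) ->
  germ (fun t => inward g e (a t)) -> germ (fun t => inward (iter n.+1 g) e (a t)).
Proof.
move=> nce cg ge aa np gin; elim: n => [//|n IH].
have ci m : continuous (iter m g) by exact: iter_continuous.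
have nf : germ (fun t => iter n.+2 g (a t) <> a t).
  by apply: germ_mono np => t _ + ga; apply; exists n.+2.
have [//|gout] := germ_dichotomy (ci n.+2) aa nf.
case: (inward_comp nce cg ge (ci n.+1) (iter_fixed n.+1 ge) aa gin IH).
by apply: germ_mono gout => t _; rewrite /outward /= -iterSr.
Qed.

End germs.

(** * Flowing to a fixed point *)

Section flow.
Context {R : realType} {D : metricType R}.
Hypothesis Dd : dendrite D.
Variables (g : D -> D) (x : D).
Hypothesis cg : continuous g.

(** [z] is the end of an itinerary from [x]: each earlier point has its image ahead. *)
Definition flows z := forall y, seg x z y -> y <> z -> linked y z (g y).

(** The sets of points beyond the members of [A] are closed and nested, so some [w] lies beyond all
    of [A]. Hence [A] lies on the arc from [x] to [w], and the supremum of its parameters gives the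
    bound. *)
Lemma flows_chain_bound (A : set D) : A `<=` flows -> A !=set0 ->
  (forall z z', A z -> A z' -> seg x z' z \/ seg x z z') ->
  exists2 z, flows z & forall y, A y -> seg x z y.
Proof.
move=> Afl A0 Atot.
have Dc : compact [set: D] by have [[]] := Dd.
pose K z := [set w | seg x w z].
have cK z : closed (K z).
  rewrite (_ : K z = ~` [set w | linked z x w]) //.
  by apply: open_closedC; exact: linked_open.
pose F := filter_from A K.
have FF : ProperFilter F.
  apply: filter_from_proper; last by move=> z Az; exists z; exact: segr.
  apply: filter_from_filter => // y z Ay Az.
  have [yz|zy] := Atot y z Ay Az.
    by exists z => // w zw; split => //; exact: (seg_trans Dd zw).
  by exists y => // w yw; split => //; exact: (seg_trans Dd yw).
have [w [_ clw]] : [set: D] `&` cluster F !=set0 by apply: Dc; exact: filterT.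
have Aw z : A z -> seg x w z.
  move=> Az; apply: (cK z) => B Bw; apply: clw => //.
  by exists z.
have [xw|/eqP xw] := eqVneq x w.
  have Ax y : A y -> y = x by move=> /Aw; rewrite -xw => /segxx.
  exists x; last by move=> y /Ax ->; exact: segl.
  by have [z Az] := A0; rewrite -(Ax z Az); exact: Afl.
have [a aa] := dendrite_has_arc Dd xw; have [_ a0 _ ainj] := aa.
pose S := [set t | 0 <= t <= 1 /\ A (a t)].
have AS z : A z -> exists2 t, S t & a t = z.
  move=> Az; have [t t01 az] := seg_arcP Dd aa (Aw z Az).
  by exists t => //; split => //; rewrite az.
have S0 : S !=set0 by have [z /AS[t St _]] := A0; exists t.
have ubS : has_ubound S by exists 1 => t [/andP[]].
have leS t : S t -> t <= sup S by exact: ub_le_sup.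
have s01 : 0 <= sup S <= 1.
  have [t St] := S0; have := leS t St; have [t01 _] := St.
  have : sup S <= 1 by apply: ge_sup => // u [/andP[]].
  lra.
exists (a (sup S)); last first.
  move=> z /AS[t St <-]; apply/(arc_seg0P Dd _ aa s01); exists t => //.
  by have [t01 _] := St; have := leS t St; lra.
move=> y /(arc_seg0P Dd _ aa s01)[s ss <-] sne.
have ss' : s < sup S.
  rewrite lt_neqAle; apply/andP; split; last by case/andP: ss.
  by apply/eqP => sE; apply: sne; rewrite sE.
have [t [t01 At] st] := sup_gt S0 ss'.
have ts := leS t (conj t01 At).
apply: (linked_trans (q := a t)).
  by apply: (arc_linked aa); lra.
apply: (Afl _ At).
  by apply/(arc_seg0P Dd _ aa t01); exists s => //; lra.
by move=> /ainj H; have := H ltac:(lra) t01; lra.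
Qed.

(** If [g] moves [e], it does not move it back towards [x], as points just before [e] would then be
    sent back too. So [e] lies between [x] and [g e], and the itinerary can be prolonged. *)
Lemma flows_maximal_fixed e : flows e -> (forall z, flows z -> seg x z e -> z = e) ->
  g e = e.
Proof.
move=> fe emax; apply: contrapT => ge.
have xge : seg x (g e) e.
  move=> exg; have [xe _] := linked_neq exg.
  have [a aa] := dendrite_has_arc Dd xe; have [ca a0 a1 ainj] := aa.
  have [d d0 hd] : exists2 d : R, 0 < d & forall s, `|1 - s| < d -> inward g x (a s).
    by apply: inward_open => //; rewrite /inward a1.
  pose m := Num.min (d / 2) 2^-1.
  have m0 : 0 < m by rewrite lt_min; lra.
  have [m1 m2] : m <= d / 2 /\ m <= 2^-1 by split; rewrite ge_min lexx ?orbT.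
  have := hd (1 - m) ltac:(rewrite ltr_norml; lra); rewrite /inward => xs.
  apply: (arc_separated Dd aa (t := 1 - m)); first lra.
  apply: linked_trans xs (linked_sym _); apply: fe.
    by rewrite -(arc_seg Dd aa); exists (1 - m) => //=; rewrite in_itv /=; lra.
  by rewrite -a1 => /ainj H; have := H ltac:(lra) ltac:(lra); lra.
have xge' : x <> g e by move=> xE; apply: ge; move: xge; rewrite -xE => /segxx.
have [a aa] := dendrite_has_arc Dd xge'; have [ca a0 a1 ainj] := aa.
have [c c01 ace] := seg_arcP Dd aa xge.
have c1 : c < 1.
  rewrite lt_neqAle; apply/andP; split; last by case/andP: c01.
  by apply/eqP => c1; apply: ge; rewrite -{2}ace c1 a1.
have [d d0 hd] : exists2 d : R, 0 < d & forall s, `|c - s| < d -> inward g (g e) (a s).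
  by apply: inward_open => //; rewrite /inward ace; exact: linkedxx.
pose m := Num.min (d / 2) (1 - c).
have m0 : 0 < m by rewrite lt_min; lra.
have [m1 m2] : m <= d / 2 /\ m <= 1 - c by split; rewrite ge_min lexx ?orbT.
have cm01 : 0 <= c + m <= 1 by lra.
(* A point just past [e] on the way to [g e] ends an itinerary: up to [e] by [fe], and from [e] on
   because nearby images stay ahead by continuity. *)
have : a (c + m) = e.
  apply: emax; last by apply/(arc_seg0P Dd _ aa cm01); exists c => //; lra.
  move=> y /(arc_seg0P Dd _ aa cm01)[s scm <-] sne.
  have {sne}scm' : s < c + m.
    rewrite lt_neqAle; apply/andP; split; last by case/andP: scm.
    by apply/eqP => sE; apply: sne; rewrite sE.
  have [sc|cs] := ltP s c.
    apply: (linked_trans (q := e)).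
      by rewrite -ace; apply: (arc_linked aa); lra.
    apply: fe; first by rewrite -ace; apply/(arc_seg0P Dd _ aa c01); exists s => //; lra.
    by rewrite -ace => /ainj H; have := H ltac:(lra) ltac:(lra); lra.
  apply: (linked_trans (q := g e)); last by apply: hd; rewrite ltr_norml; lra.
  by rewrite -a1; apply: (arc_linked aa); lra.
by rewrite -ace => /ainj H; have := H cm01 c01; lra.
Qed.

Lemma flow_to_fixed_point : exists2 e, g e = e & flows e.
Proof.
have fx : flows x by move=> y /segxx ->.
pose T := {z | flows z}.
pose le (z z' : T) := `[< seg x (sval z') (sval z) >].
have [||||e emax] := @Zorn T le.
- by move=> z; apply/asboolP; exact: segr.
- by move=> r s t /asboolP rs /asboolP st; apply/asboolP; exact: (seg_trans Dd st rs).
- move=> [s fs] [t ft] /asboolP /= st /asboolP /= ts.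
  have est : s = t by exact: (seg_anti Dd ts st).
  by subst t; congr exist; exact: Prop_irrelevance.
- move=> A Atot; have [A0|/set0P/negP/negPn/eqP A0] := pselect (A !=set0); last first.
    by exists (exist _ x fx) => s; rewrite A0.
  have [||z z' [u Au <-] [v Av <-]|w fw wub] := @flows_chain_bound (sval @` A).
  + by move=> _ [[z fz] _ <-].
  + by have [z Az] := A0; exists (sval z), z.
  + by have [/asboolP|/asboolP] := Atot u v Au Av; [left|right].
  + exists (exist _ w fw) => s As; apply/asboolP; apply: wub; by exists s.
exists (sval e); last exact: (svalP e).
apply: flows_maximal_fixed; first exact: (svalP e).
move=> z fz ez; have := emax (exist _ z fz) ltac:(exact/asboolP).
by move/(congr1 sval).
Qed.

End flow.

(** * Descent to a contradiction from finitely many periodic cutpoints *)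

Section repelling.
Context {R : realType} {D : metricType R}.
Hypothesis Dd : dendrite D.
Variable f : D -> D.
Hypothesis f_cont : continuous f.

Let F := [set z : D | periodic_point f z /\ cutpoint z].
Hypothesis F_finite : finite_set F.

Lemma nbhs_avoid_periodic_cutpoints e : nbhs e [set z | F z -> z = e].
Proof.
have cF : closed (F `\ e).
  apply: compact_closed; first exact: metric_hausdorff.
  by apply: finite_compact; exact: sub_finite_set F_finite.
apply: filterS (open_nbhs_nbhs (conj (closed_openC cF) _)).
  by move=> z nFz Fz; apply: contrapT => ze; apply: nFz.
by move=> [_ /(_ erefl)].
Qed.

(** Interior points of an arc are cutpoints, so periodic ones belong to the finite set [F]. *)
Lemma germ_not_periodic a e b : arc a e b -> germ (fun t => ~ periodic_point f (a t)).
Proof.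
move=> aa; have [ca a0 _ ainj] := aa.
have [d d01 hd] := near_germ ca a0 (nbhs_avoid_periodic_cutpoints e).
exists (d / 2) => [|t td pt]; first lra.
have t01 : 0 < t < 1 by lra.
have /= := hd t ltac:(lra) (conj pt (arc_interior_cutpoint Dd aa t01)).
by rewrite -a0 => /ainj H; have := H ltac:(lra) ltac:(lra); lra.
Qed.

Lemma periodic_iter n z : (0 < n)%N -> periodic_point (iter n f) z -> periodic_point f z.
Proof. by move=> n0 [m [m0 mz]]; exists (m * n)%N; rewrite muln_gt0 m0 n0 iterM. Qed.

(* A point near [e] pushed away from [e], off the given arc, forces the same on a
   common initial piece of the arc. *)
Lemma weakly_repelling_outward n e B a b : (0 < n)%N ->
  weakly_repelling_fixed_in (iter n f) e B -> B b -> arc a e b ->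
  germ (fun t => outward (iter n f) e (a t)).
Proof.
move=> n0 [qe [p pe Bp] wr] Bb aa; set q := iter n f in qe wr *.
have cq : continuous q by exact: iter_continuous.
have [_ Dlc _] := Dd.
have [U [oU cU Ue UF]] := Dlc e _ (nbhs_avoid_periodic_cutpoints e).
have [x [Ux Bx xcase]] := wr U (open_nbhs_nbhs (conj oU Ue)).
have xe : x <> e by move: Bx; rewrite -Bp => /linked_neq[].
have {xcase}outx : outward q e x.
  case: xcase => [[qx cx]|/separates_outward //]; case: xe; apply: (UF x Ux).
  by split => //; exists n.
have [c cc] := dendrite_has_arc Dd (nesym xe); have [_ c0 c1 cinj] := cc.
have cU' t : 0 <= t <= 1 -> U (c t).
  move=> t01; apply: (connected_seg_sub cU Ue Ux).
  by rewrite -(arc_seg Dd cc); exists t.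
have outc t : 0 < t <= 1 -> outward q e (c t).
  apply: (outward_down (t0 := 1) Dd cq cc); [lra|by rewrite c1|move=> s s01 qs].
  have : c s = e.
    apply: UF; first by apply: cU'; lra.
    by split; [exists n|exact: (arc_interior_cutpoint Dd cc)].
  by rewrite -c0 => /cinj H; have := H ltac:(lra) ltac:(lra); lra.
have [ca a0 a1 ainj] := aa.
have exb : linked e x b.
  by move: Bx Bb; rewrite -Bp => px pb; exact: linked_trans (linked_sym px) pb.
(* As [x] and [b] are linked off [e], they are linked off [a d] for small [d]; hence [a d] also lies
   on the arc [c] to [x], all of which is outward. *)
have /(linked_near Dd)[r r0 hr] := exb.
have er : nbhs e [set z | mdist e z < r] by apply/nbhs_mdistE; exists r.
have [d d01 hd] := germI (germ_not_periodic aa) (near_germ ca a0 er).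
have dseg : seg e b (a d) by rewrite -(arc_seg Dd aa); exists d => //=; rewrite in_itv /=; lra.
have dxb : linked (a d) x b by apply: hr; rewrite ?mdistxx //; have [] := hd d ltac:(lra).
have dx : seg e x (a d) by move=> dex; apply: dseg; exact: linked_trans dxb.
have [s s01 csd] := seg_arcP Dd cc dx.
exists d => // t td; apply: (outward_down Dd cq aa d01) => //.
  rewrite -csd; apply: outc.
  suff : s != 0 by move: s01; rewrite le_eqVlt eq_sym => /andP[/orP[/eqP ->|->]//]; rewrite eqxx.
  apply/eqP => s0; move: csd; rewrite s0 c0 -a0 => /ainj H.
  by have := H ltac:(lra) ltac:(lra); lra.
by move=> u ud qu; have [+ _] := hd u ltac:(lra); apply; exists n.
Qed.

Lemma weakly_repelling_outward_iter n k e B a b : (0 < n)%N -> (0 < k)%N ->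
  weakly_repelling_fixed_in (iter n f) e B -> B b -> arc a e b ->
  germ (fun t => outward (iter (k * n) f) e (a t)).
Proof.
case: k => [//|k] n0 _ wr Bb aa; have [qe _ _] := wr.
have -> : iter (k.+1 * n) f = iter k.+1 (iter n f) by apply/funext => z; rewrite iterM.
have cq : continuous (iter n f) by exact: iter_continuous.
apply: (@outward_iter _ _ Dd (iter n f) e b a k cq qe aa).
  by apply: germ_mono (germ_not_periodic aa) => t _ np /(periodic_iter n0).
exact: weakly_repelling_outward wr Bb aa.
Qed.

Hypothesis f_rep : forall a : D, periodic_point f a -> weakly_repelling f a.

Lemma ex_not_periodic : exists x, ~ periodic_point f x.
Proof.
have [[[p _] _ _] _ _] := Dd.
have [pp|] := pselect (periodic_point f p); last by exists p.
have [n [B [_ [_ [b nb _] _]]]] := f_rep pp.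
have [a aa] := dendrite_has_arc Dd (nesym nb).
by have [t _ np] := germ_ex (germ_not_periodic aa); exists (a t).
Qed.

(** [N] is the product, over the finite set [F], of exponents at which its points repel. *)
Lemma common_repelling_iterate : exists2 N, (0 < N)%N & forall e, F e ->
  exists n k B, [/\ (0 < n)%N, (0 < k)%N, N = (k * n)%N &
    weakly_repelling_fixed_in (iter n f) e B].
Proof.
have /finite_seqP[s sF] := F_finite.
have /choice[n Hn] : forall e, exists n, F e -> (0 < n)%N /\
    exists B, weakly_repelling_fixed_in (iter n f) e B.
  move=> e; have [[pe _]|nF] := pselect (F e); last by exists 0%N.
  by have [n [B [n0 wr]]] := f_rep pe; exists n => _; split => //; exists B.
have n0 e : e \in s -> (0 < n e)%N.
  by move=> es; have [] := Hn e ltac:(by rewrite sF).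
exists (\prod_(e <- s) n e)%N; first by rewrite big_seq; exact: prodn_cond_gt0.
move=> e Fe; have [ne0 [B wr]] := Hn e Fe.
have es : e \in s by move: Fe; rewrite sF.
exists (n e), (\prod_(e <- rem e s) n e)%N, B; split => //.
  by rewrite big_seq; apply: prodn_cond_gt0 => z /mem_rem; exact: n0.
by rewrite (big_rem e) //= mulnC.
Qed.

Lemma seg_outside_component (e b x x' : D) : linked e b x' -> x <> e -> ~ linked e b x ->
  linked x e x' /\ linked x' e x.
Proof.
move=> bx' xe nbx; have [_ x'e] := linked_neq bx'.
split; apply: contrapT => sg; apply: nbx.
  by apply: linked_trans bx' (linked_sym _); exact: (seg_linked Dd sg).
by apply: linked_trans bx' _; exact: (seg_linked Dd sg).
Qed.

(** [e] separates [x] from [x']. The branch at [x'] points away from [e], while the branch at [x]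
    contains [e] and everything across it. *)
Lemma outward_branch_sub (g : D -> D) (e b x x' : D) : linked e b x' -> x <> e ->
  ~ linked e b x -> linked x (g x) e -> outward g e x' ->
  [set y | linked x' (g x') y] `<=` [set y | linked x (g x) y].
Proof.
move=> bx' xe nbx xge out y /= x'y.
have [xex' x'ex] := seg_outside_component bx' xe nbx.
apply: linked_trans xge _; apply: linked_trans xex' _; apply: contrapT => sx.
have ey := outward_seg out x'y.
by have [_ /(_ x'ex)] := seg_between Dd ey sx.
Qed.

Lemma count_lt (T : eqType) (P Q : pred T) (s : seq T) e :
  (forall y, P y -> Q y) -> e \in s -> Q e -> ~~ P e -> (count P s < count Q s)%N.
Proof.
move=> PQ; elim: s => [//|y s IH]; rewrite inE => /orP[/eqP <-|es] Qe nPe /=.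
  by rewrite Qe (negbTE nPe) ltnS sub_count.
by rewrite -addnS leq_add ?IH //; case: (boolP (P y)) => // /PQ ->.
Qed.

Lemma finite_periodic_cutpoints_absurd : False.
Proof.
have [N N0 HN] := common_repelling_iterate; set g := iter N f in HN *.
have cg : continuous g by exact: iter_continuous.
have [s sF] := (finite_seqP _).1 F_finite.
(* The quantity that descends: the number of periodic cutpoints on the side to which [g] moves
   [x]. *)
pose mu x := count (fun y => `[< linked x (g x) y >]) s.
suff step x : g x <> x -> exists2 x', g x' <> x' & (mu x' < mu x)%N.
  (* Descent on [mu] makes every point fixed by [g], against [ex_not_periodic]. *)
  have nog n x : (mu x < n)%N -> g x = x.
    elim: n x => [//|n IH] x mux; apply: contrapT => /step[x' gx' x'x]; apply: gx'.
    by apply: IH; exact: leq_trans x'x _.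
  by have [x] := ex_not_periodic; apply; exists N; split => //; exact: nog (ltnSn _).
move=> gx; have [e ge fe] := flow_to_fixed_point Dd x cg.
have ex : e <> x by move=> ex; apply: gx; rewrite -ex.
have xge : linked x (g x) e by apply: linked_sym; apply: fe; [exact: segl|exact: nesym].
have [a aa] := dendrite_has_arc Dd ex; have [_ a0 _ ainj] := aa.
have ain : germ (fun t => inward g e (a t)).
  exists 1 => [|t t01]; first lra.
  apply: fe; last by rewrite -a0 => /ainj H; have := H ltac:(lra) ltac:(lra); lra.
  move=> /linked_sym; have : seg e x (a t); last exact.
  by rewrite -(arc_seg Dd aa); exists t => //=; rewrite in_itv /=; lra.
have pe : periodic_point f e by exists N.
have [ce|nce] := pselect (cutpoint e).
  have [n [k [B [n0 k0 NE wr]]]] := HN e (conj pe ce).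
  have outg b a' : B b -> arc a' e b -> germ (fun t => outward g e (a' t)).
    by rewrite /g NE => Bb aa'; exact: weakly_repelling_outward_iter wr Bb aa'.
  have [_ [b be BE] _] := wr.
  (* If [x] lay in the repelling component, its arc would be both inward and outward at [e]. So [x']
     is taken across [e], and [e] is counted for [x] but not for [x']. *)
  have [bx|nbx] := pselect (linked e b x).
    have Bx : B x by rewrite -BE.
    by have [t _ [int [_ _ /(_ int)]]] := germ_ex (germI ain (outg x a Bx aa)).
  have [a' aa'] := dendrite_has_arc Dd (nesym be).
  have Bb : B b by rewrite -BE; exact: linkedxx.
  have [t t01 out] := germ_ex (outg b a' Bb aa').
  have bx' : linked e b (a' t).
    by have [_ <- <- _] := aa'; apply: (arc_linked aa'); lra.
  have [_ gx' nx'e] := out.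
  exists (a' t) => //; apply: (count_lt (e := e)).
  - move=> y /asboolP ya; apply/asboolP.
    exact: (outward_branch_sub bx' (nesym ex) nbx xge out ya).
  - have : F e by [].
    by rewrite sF.
  - exact/asboolP.
  - by apply/asboolP => /linked_sym.
have [n [B [n0 wr]]] := f_rep pe.
have Bx : B x.
  have [_ [b be <-] _] := wr; apply: not_cutpoint_linked => //; exact: nesym.
have npg : germ (fun t => ~ periodic_point g (a t)).
  by apply: germ_mono (germ_not_periodic aa) => t _ np /(periodic_iter N0).
(* The iterate of order [N * n] is inward as a power of [g] and outward as a power of [iter n f];
   the predecessor offsets the successor in [inward_iter]. *)
have := @inward_iter _ _ Dd g e x a n.-1 nce cg ge aa npg ain.
have -> : iter n.-1.+1 g = iter (N * n) f.
  by apply/funext => z; rewrite prednK // mulnC iterM.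
move=> gin; have gout := weakly_repelling_outward_iter n0 N0 wr Bx aa.
by have [t _ [int [_ _ /(_ int)]]] := germ_ex (germI gin gout).
Qed.

End repelling.

Theorem theorem3p7 (R : realType) (D : metricType R) (f : D -> D)
    (D_dendrite : dendrite D)
    (f_cont : continuous f)
    (f_rep : forall a : D, periodic_point f a -> weakly_repelling f a) :
  infinite_set [set x : D | periodic_point f x /\ cutpoint x].
Proof.
by move=> F_finite; exact: (finite_periodic_cutpoints_absurd D_dendrite f_cont F_finite f_rep).
Qed.
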